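(* Let $E \subset \mathbb{R}^2$ be compact, $\varepsilon > 0$, and let $x \in \partial E_\varepsilon$ be a boundary point of $E_\varepsilon$ that is not smooth. Then $x$ belongs to precisely one of the following eight categories: (S1) wedge, (S2) sharp singularity, (S3) sharp-sharp singularity, (S4) shallow singularity, (S5) shallow-shallow singularity, (S6) chain singularity, (S7) chain-chain singularity, (S8) sharp-chain singularity.
   Context: $B_r(x)$ is the open Euclidean ball and $E_\varepsilon := \overline{\bigcup_{p \in E} B_\varepsilon(p)}$. For $x \in \partial E_\varepsilon$ the set of contributors is $\Pi_E(x) = \{y \in \partial E : \|y-x\| = \varepsilon\}$, and $\mathrm{Unp}_\varepsilon(E) := \{x \in \partial E_\varepsilon : \Pi_E(x) \text{ is a singleton}\}$. A point $x \in \partial E_\varepsilon$ is smooth if there is $r>0$ with $\partial E_\varepsilon \cap B_r(x) \subset \mathrm{Unp}_\varepsilon(E)$; otherwise it is a singularity, and $S(E_\varepsilon)$ denotes the set of singularities. A vector $\xi \in S^1$ is an outward direction at $x$ if there is a sequence $(x_n) \subset \mathbb{R}^2 \setminus E_\varepsilon$ with $x_n \to x$ and $(x_n - x)/\|x_n - x\| \to \xi$; the set of these is $\Xi_x(E_\varepsilon)$. If $\xi \in \Xi_x(E_\varepsilon)$ and $y \in \Pi_E(x)$ satisfy $\langle y - x, \xi\rangle = 0$, then $\xi$ is an extremal outward direction and $y$ an extremal contributor at $x$; the sets of these are $\Xi_x^{\mathrm{ext}}(E_\varepsilon)$ and $\Pi_E^{\mathrm{ext}}(x)$. Each of these two sets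 has one or two elements; write $\Xi_x^{\mathrm{ext}}(E_\varepsilon) = \{\xi_1,\xi_2\}$, allowing $\xi_1=\xi_2$, and similarly $\Pi_E^{\mathrm{ext}}(x_n) = \{y_n^{(1)}, y_n^{(2)}\}$, possibly with equal elements. For $v \in S^1$ let $U_r(x,v) := \{z \in B_r(x) : \langle z - x, v\rangle > 0\}$. A singularity $x\in S(E_\varepsilon)$ is (with a suitable labelling of $\xi_1,\xi_2$): S1 (wedge): if $\xi_1 \notin \{\xi_2, -\xi_2\}$. S2 (one-sided sharp singularity): if $\xi_1 = \xi_2$ and $B_\delta(x) \setminus E_\varepsilon$ is connected for some $\delta>0$. S3 (sharp-sharp singularity): if $x \notin \mathrm{Unp}_\varepsilon(E)$, $\xi_1 = -\xi_2$, and for each $i \in \{1,2\}$ there is $\delta_i>0$ for which $U_{\delta_i}(x,\xi_i) \setminus E_\varepsilon$ is connected. S4 (one-sided shallow singularity): if $x \in \mathrm{Unp}_\varepsilon(E)$, $U_{\delta_1}(x,\xi_1)\cap \partial E_\varepsilon \subset \mathrm{Unp}_\varepsilon(E)$ for some $\delta_1>0$, and $U_{\delta_2}(x,\xi_2)\cap \partial E_\varepsilon \not\subset \mathrm{Unp}_\varepsilon(E)$ for all $\delta_2>0$. S5 (shallow-shallow singularity): if $x \in \mathrm{Unp}_\varepsilon(E)$ and $U_{\delta}(x,\xi_i)\cap \partial E_\varepsilon \not\subset \mathrm{Unp}_\varepsilon(E)$ for all $\delta>0$ and $i\in\{1,2\}$. S6 (one-sided chain singularity): if $\xi_1=\xi_2$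 and there is a sequence $(x_n) \subset S(E_\varepsilon)\setminus\{x\}$ with $x_n \to x$ and $\left\langle \frac{y_n^{(1)}-x_n}{\varepsilon}, \frac{y_n^{(2)}-x_n}{\varepsilon}\right\rangle \to -1$, where $\{y_n^{(1)},y_n^{(2)}\} = \Pi_E^{\mathrm{ext}}(x_n)$. S7 (chain-chain singularity): if $\xi_1=-\xi_2$ and for each $i\in\{1,2\}$ there are $\delta_i>0$ and a sequence $(x_{i,n})_n \subset U_{\delta_i}(x,\xi_i)\cap S(E_\varepsilon)$ with $x_{i,n}\to x$ and $\left\langle \frac{y_{i,n}^{(1)}-x_{i,n}}{\varepsilon}, \frac{y_{i,n}^{(2)}-x_{i,n}}{\varepsilon}\right\rangle \to -1$, where $\{y_{i,n}^{(1)},y_{i,n}^{(2)}\} = \Pi_E^{\mathrm{ext}}(x_{i,n})$. S8 (sharp-chain singularity): if $\xi_1=-\xi_2$, there is $\delta_1>0$ for which $U_{\delta_1}(x,\xi_1)\setminus E_\varepsilon$ is connected, and there are $\delta_2>0$ and a sequence $(x_n) \subset U_{\delta_2}(x,\xi_2)\cap S(E_\varepsilon)$ with $x_n\to x$ and $\left\langle \frac{y_n^{(1)}-x_n}{\varepsilon}, \frac{y_n^{(2)}-x_n}{\varepsilon}\right\rangle \to -1$, where $\{y_n^{(1)},y_n^{(2)}\} = \Pi_E^{\mathrm{ext}}(x_n)$. *)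

(* Defs.v *)
From HB Require Import structures.
From mathcomp Require Import all_boot all_order all_algebra.
From mathcomp Require Import all_classical all_reals all_analysis.

Set Implicit Arguments.
Unset Strict Implicit.
Unset Printing Implicit Defensive.

Import Order.TTheory GRing.Theory Num.Theory.
Import numFieldNormedType.Exports.

Local Open Scope classical_set_scope.
Local Open Scope ring_scope.

(* The plane is 'rV[R]_2 with its library topology, which is the Euclidean one.
   The library norm `|_| and [ball] on row vectors are those of the sup norm,
   so the Euclidean norm and balls are introduced separately. *)

Definition dot (R : realType) (u v : 'rV[R]_2) : R :=
  \sum_(i < 2) u 0 i * v 0 i.

Definition enorm (R : realType) (u : 'rV[R]_2) : R := Num.sqrt (dot u u).

Definition eball (R : realType) (x : 'rV[R]_2) (r : R) : set 'rV[R]_2 :=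
  [set z | enorm (z - x) < r].

Definition half_ball (R : realType) (x v : 'rV[R]_2) (r : R) :
    set 'rV[R]_2 :=
  [set z | eball x r z /\ 0 < dot (z - x) v].

Definition boundary (T : topologicalType) (A : set T) : set T :=
  closure A `\` interior A.

Section Neighbourhood.
Variables (R : realType) (E : set 'rV[R]_2) (eps : R).
Implicit Types (x y xi : 'rV[R]_2).

Definition nbhd : set 'rV[R]_2 := closure (\bigcup_(p in E) eball p eps).

Definition contributors x : set 'rV[R]_2 :=
  [set y | boundary E y /\ enorm (y - x) = eps].

Definition unp : set 'rV[R]_2 :=
  [set x | boundary nbhd x /\ exists y, contributors x = [set y]].

Definition smooth_point x : Prop :=
  boundary nbhd x /\
  exists r : R, 0 < r /\ boundary nbhd `&` eball x r `<=` unp.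

Definition singularities : set 'rV[R]_2 :=
  [set x | boundary nbhd x /\ ~ smooth_point x].

(* As [nbhd] is closed, u n != x holds automatically for x on its boundary, so
   no division by zero occurs in the normalization. *)
Definition outward_directions x : set 'rV[R]_2 :=
  [set xi | enorm xi = 1 /\
    exists u : nat -> 'rV[R]_2,
      [/\ forall n, ~ nbhd (u n),
          u n @[n --> \oo] --> x &
          (enorm (u n - x))^-1 *: (u n - x) @[n --> \oo] --> xi]].

Definition extremal_directions x : set 'rV[R]_2 :=
  [set xi | outward_directions x xi /\
    exists y, contributors x y /\ dot (y - x) xi = 0].

Definition extremal_contributors x : set 'rV[R]_2 :=
  [set y | contributors x y /\
    exists xi, outward_directions x xi /\ dot (y - x) xi = 0].

Definition sharp_side x xi : Prop :=
  exists d : R, 0 < d /\ connected (half_ball x xi d `\` nbhd).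

Definition smooth_side x xi : Prop :=
  exists d : R, 0 < d /\ half_ball x xi d `&` boundary nbhd `<=` unp.

Definition shallow_side x xi : Prop :=
  forall d : R, 0 < d -> ~ (half_ball x xi d `&` boundary nbhd `<=` unp).

Definition chain_sequence x (u : nat -> 'rV[R]_2) : Prop :=
  [/\ forall n, singularities (u n),
      u n @[n --> \oo] --> x &
      exists y1 y2 : nat -> 'rV[R]_2,
        (forall n, extremal_contributors (u n) = [set y1 n; y2 n]) /\
        dot (eps^-1 *: (y1 n - u n)) (eps^-1 *: (y2 n - u n))
          @[n --> \oo] --> (-1 : R)].

Definition chain_side x xi : Prop :=
  exists d : R, 0 < d /\
  exists u : nat -> 'rV[R]_2,
    (forall n, half_ball x xi d (u n)) /\ chain_sequence x u.

Inductive singularity_type : Set :=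
  | Wedge
  | Sharp
  | SharpSharp
  | Shallow
  | ShallowShallow
  | Chain
  | ChainChain
  | SharpChain.

Definition type_condition x (xi1 xi2 : 'rV[R]_2) (t : singularity_type) :
    Prop :=
  match t with
  | Wedge => xi1 <> xi2 /\ xi1 <> - xi2
  | Sharp =>
      xi1 = xi2 /\ exists d : R, 0 < d /\ connected (eball x d `\` nbhd)
  | SharpSharp =>
      [/\ ~ unp x, xi1 = - xi2, sharp_side x xi1 & sharp_side x xi2]
  | Shallow => [/\ unp x, smooth_side x xi1 & shallow_side x xi2]
  | ShallowShallow => [/\ unp x, shallow_side x xi1 & shallow_side x xi2]
  | Chain =>
      xi1 = xi2 /\
      exists u : nat -> 'rV[R]_2,
        (forall n, u n <> x) /\ chain_sequence x u
  | ChainChain => [/\ xi1 = - xi2, chain_side x xi1 & chain_side x xi2]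
  | SharpChain => [/\ xi1 = - xi2, sharp_side x xi1 & chain_side x xi2]
  end.

(* The existential quantifiers range over all labellings of the one or two
   extremal outward directions at x. *)
Definition has_type x (t : singularity_type) : Prop :=
  exists xi1 xi2 : 'rV[R]_2,
    extremal_directions x = [set xi1; xi2] /\ type_condition x xi1 xi2 t.

End Neighbourhood.

(* Main.v *)
(* The contributors of a boundary point x all lie in the closed half plane
   opposite to any outward direction xi0, hence on a half circle; its two
   outermost contributors are the extremal ones.  If they coincide, x has one
   contributor and its extremal directions are opposite; if they are neither
   equal nor antipodal, x is a wedge; if they are antipodal, the complement of
   the neighbourhood near x lies in the cusps between the two tangent disks
   centred at x + eps n and x - eps n, on one or both sides.

   In a cusp, seen in polar coordinates around x, every point of E that covers a
   nearby point lies close to one of the two centres and so covers the whole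
   part of the arc |z - x| = r above (resp. below) that point.  Hence the
   uncovered part of each arc is an interval.  Call a boundary point in the cusp
   pinched if it has contributors near both centres: the arc through it is then
   completely covered.  If pinched points accumulate at x, these arcs disconnect
   the complement, and they are singularities whose extremal contributors tend
   to be antipodal (chain).  Otherwise the set of radii of uncovered points is
   open and closed in a small interval ]0, d[, every arc meets the complement in
   a nonempty interval, and the complement is connected (sharp). *)
Require Import Defs.
From mathcomp Require Import all_boot all_order all_algebra.
From mathcomp Require Import all_classical all_reals all_analysis.
From mathcomp Require Import ring lra.
Import Order.TTheory GRing.Theory Num.Theory.
Import numFieldNormedType.Exports.
Local Open Scope classical_set_scope.
Local Open Scope ring_scope.

Set Implicit Arguments.
Unset Strict Implicit.
Unset Printing Implicit Defensive.

(** * Plane geometry *)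

Section Plane.
Variable R : realType.
Implicit Types u v w x z xi : 'rV[R]_2.

Lemma dotE u v : dot u v = u 0 0 * v 0 0 + u 0 1 * v 0 1.
Proof.
rewrite /dot big_ord_recl big_ord1; congr (_ + u 0 _ * v 0 _); exact/val_inj.
Qed.

Definition perp u : 'rV[R]_2 := \row_i (if i == 0 then - u 0 1 else u 0 0).

Lemma perp0 u : perp u 0 0 = - u 0 1. Proof. by rewrite mxE. Qed.
Lemma perp1 u : perp u 0 1 = u 0 0. Proof. by rewrite mxE. Qed.

Lemma dotC u v : dot u v = dot v u.
Proof. by rewrite !dotE; ring. Qed.
Lemma dotDl u v w : dot (u + v) w = dot u w + dot v w.
Proof. by rewrite !dotE !mxE; ring. Qed.
Lemma dotDr w u v : dot w (u + v) = dot w u + dot w v.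
Proof. by rewrite !dotE !mxE; ring. Qed.
Lemma dotNl u w : dot (- u) w = - dot u w.
Proof. by rewrite !dotE !mxE; ring. Qed.
Lemma dotNr w u : dot w (- u) = - dot w u.
Proof. by rewrite !dotE !mxE; ring. Qed.
Lemma dotBl u v w : dot (u - v) w = dot u w - dot v w.
Proof. by rewrite dotDl dotNl. Qed.
Lemma dotBr w u v : dot w (u - v) = dot w u - dot w v.
Proof. by rewrite dotDr dotNr. Qed.
Lemma dotZl k u w : dot (k *: u) w = k * dot u w.
Proof. by rewrite !dotE !mxE; ring. Qed.
Lemma dotZr k w u : dot w (k *: u) = k * dot w u.
Proof. by rewrite !dotE !mxE; ring. Qed.

Lemma dot_sqrB u v : dot (u - v) (u - v) = dot u u - 2 * dot u v + dot v v.
Proof. by rewrite !dotE !mxE; ring. Qed.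

Lemma dot_perp u : dot u (perp u) = 0.
Proof. by rewrite dotE perp0 perp1; ring. Qed.
Lemma dot_perpl u : dot (perp u) u = 0.
Proof. by rewrite dotC dot_perp. Qed.
Lemma dot_perp_perp u v : dot (perp u) (perp v) = dot u v.
Proof. by rewrite !dotE !perp0 !perp1; ring. Qed.
Lemma perpN u : perp (- u) = - perp u.
Proof.
by apply/rowP => i; rewrite !mxE; case: ifP => _; rewrite ?mxE.
Qed.
Lemma dot_ge0 u : 0 <= dot u u.
Proof. by rewrite dotE addr_ge0// -expr2 sqr_ge0. Qed.

Lemma sqr_coord_le u j : u 0 j ^+ 2 <= dot u u.
Proof.
rewrite dotE; case: j => -[|[|//]] j2.
  have -> : Ordinal j2 = 0 by exact/val_inj.
  by rewrite expr2 lerDl -expr2 sqr_ge0.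
have -> : Ordinal j2 = 1 by exact/val_inj.
by rewrite expr2 lerDr -expr2 sqr_ge0.
Qed.

Lemma dot_eq0 u : dot u u = 0 -> u = 0.
Proof.
rewrite dotE => /eqP; rewrite paddr_eq0 -?expr2 ?sqr_ge0// !sqrf_eq0.
case/andP => /eqP u0 /eqP u1; apply/rowP => -[[|[|//]] i2]; rewrite mxE.
  by rewrite -[RHS]u0; congr (u 0 _); apply/val_inj.
by rewrite -[RHS]u1; congr (u 0 _); apply/val_inj.
Qed.

Lemma enorm_ge0 u : 0 <= enorm u.
Proof. exact: sqrtr_ge0. Qed.
Lemma sqr_enorm u : enorm u ^+ 2 = dot u u.
Proof. by rewrite /enorm sqr_sqrtr// dot_ge0. Qed.
Lemma enorm_eq0 u : enorm u = 0 -> u = 0.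
Proof. by move=> u0; apply: dot_eq0; rewrite -sqr_enorm u0 expr0n. Qed.
Lemma enorm_gt0 u : (0 < enorm u) = (u != 0).
Proof.
rewrite lt_def enorm_ge0 andbT; congr (~~ _); apply/eqP/eqP => [/enorm_eq0//|->].
by rewrite /enorm dotE !mxE !mul0r addr0 sqrtr0.
Qed.
Lemma enormN u : enorm (- u) = enorm u.
Proof. by rewrite /enorm dotNl dotNr opprK. Qed.
Lemma enormB u v : enorm (u - v) = enorm (v - u).
Proof. by rewrite -enormN opprB. Qed.
Lemma enormZ k u : enorm (k *: u) = `|k| * enorm u.
Proof.
by rewrite /enorm dotZl dotZr mulrA -expr2 sqrtrM ?sqr_ge0// sqrtr_sqr.
Qed.

Lemma enorm_ltE u r : 0 <= r -> (enorm u < r) = (dot u u < r ^+ 2).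
Proof. by move=> r0; rewrite -sqr_enorm ltr_sqr ?nnegrE ?enorm_ge0. Qed.
Lemma enorm_leE u r : 0 <= r -> (enorm u <= r) = (dot u u <= r ^+ 2).
Proof. by move=> r0; rewrite -sqr_enorm ler_sqr ?nnegrE ?enorm_ge0. Qed.
Lemma enorm_eqE u r : 0 <= r -> (enorm u = r) <-> (dot u u = r ^+ 2).
Proof.
move=> r0; rewrite -sqr_enorm; split=> [->//|/eqP].
by rewrite eqrXn2 ?enorm_ge0// => /eqP.
Qed.

Lemma cauchy_schwarz u v : `|dot u v| <= enorm u * enorm v.
Proof.
rewrite -ler_sqr ?nnegrE ?mulr_ge0 ?enorm_ge0// exprMn !sqr_enorm.
rewrite real_normK ?num_real// !dotE.
have := sqr_ge0 (u 0 0 * v 0 1 - u 0 1 * v 0 0).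
set a := u 0 0; set b := u 0 1; set c := v 0 0; set d := v 0 1 => H.
nra.
Qed.

Lemma dot_le u v : dot u v <= enorm u * enorm v.
Proof. exact: le_trans (ler_norm _) (cauchy_schwarz _ _). Qed.

Lemma enormD u v : enorm (u + v) <= enorm u + enorm v.
Proof.
rewrite enorm_leE ?addr_ge0 ?enorm_ge0//.
rewrite sqrrD !sqr_enorm dotDl !dotDr [dot v u]dotC.
have := dot_le u v; lra.
Qed.

Lemma enorm_triangle v u w : enorm (u - w) <= enorm (u - v) + enorm (v - w).
Proof. by apply: le_trans (enormD _ _); rewrite addrA subrK. Qed.

(** The vectors orthogonal to [u] form the line of [perp u]; Lagrange's identity, with the scalar
    product zero, fixes the coefficient up to sign. *)
Lemma unit_orthogonal u v e : 0 < e -> dot u u = e ^+ 2 -> dot v v = 1 ->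
  dot u v = 0 -> v = e^-1 *: perp u \/ v = - (e^-1 *: perp u).
Proof.
move=> e0 uu vv uv.
have k2 : dot v (perp u) ^+ 2 = e ^+ 2.
  rewrite -uu -[RHS]mulr1 -vv -[LHS]addr0 -[X in _ + X](expr0n _ 2) -uv.
  by rewrite !dotE perp0 perp1; ring.
have ev : e ^+ 2 *: v = dot v (perp u) *: perp u.
  rewrite -uu; apply/eqP; rewrite -subr_eq0; apply/eqP/dot_eq0.
  transitivity (dot u u * dot u v ^+ 2); last by rewrite uv expr0n mulr0.
  by rewrite !dotE !mxE /=; ring.
have vE : v = (e ^+ 2)^-1 *: (dot v (perp u) *: perp u).
  by rewrite -ev scalerA mulVf ?scale1r// expf_neq0// gt_eqF.
have e_neq0 : e != 0 by rewrite gt_eqF.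
move/eqP: k2; rewrite eqf_sqr => /orP[] /eqP ke; [left|right].
  by rewrite [LHS]vE ke scalerA; congr (_ *: _); field.
by rewrite [LHS]vE ke scalerA -scaleNr; congr (_ *: _); field.
Qed.

(** * Coordinates in an orthonormal frame *)

Section Frame.
Variables (x xi : 'rV[R]_2).
Hypothesis xi1 : dot xi xi = 1.

(** The frame has origin [x] and axes [xi] and [perp xi]. In the cusps below, [xi] is the tangent
    pointing into the cusp and [perp xi] the normal through the two centres. *)
Definition co1 z := dot (z - x) xi.
Definition co2 z := dot (z - x) (perp xi).
Definition pt (s t : R) := x + s *: xi + t *: perp xi.

Lemma parseval u v :
  dot u v = dot u xi * dot v xi + dot u (perp xi) * dot v (perp xi).
Proof.
(* The factor [dot xi xi], equal to 1, turns the expansion into a polynomial identity. *)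
transitivity (dot xi xi * dot u v); first by rewrite xi1 mul1r.
by rewrite !dotE !perp0 !perp1; ring.
Qed.

Lemma co1_pt s t : co1 (pt s t) = s.
Proof.
rewrite /co1 /pt dotBl !dotDl !dotZl xi1 dot_perpl; ring.
Qed.
Lemma co2_pt s t : co2 (pt s t) = t.
Proof.
rewrite /co2 /pt dotBl !dotDl !dotZl dot_perp dot_perp_perp xi1; ring.
Qed.

Lemma dot_co a b c d : dot (a - b) (c - d) =
  (co1 a - co1 b) * (co1 c - co1 d) + (co2 a - co2 b) * (co2 c - co2 d).
Proof. by rewrite parseval /co1 /co2 !dotBl; ring. Qed.

Lemma dist_co a b : dot (a - b) (a - b) =
  (co1 a - co1 b) ^+ 2 + (co2 a - co2 b) ^+ 2.
Proof. by rewrite dot_co; ring. Qed.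

Lemma co1_x : co1 x = 0.
Proof. by rewrite /co1 subrr dotE !mxE; ring. Qed.
Lemma co2_x : co2 x = 0.
Proof. by rewrite /co2 subrr dotE !mxE; ring. Qed.

Lemma dist_co_x a : dot (a - x) (a - x) = co1 a ^+ 2 + co2 a ^+ 2.
Proof. by rewrite dist_co co1_x co2_x !subr0. Qed.

Lemma cross_co p q : dot (p - x) (perp (q - x)) =
  co2 p * co1 q - co1 p * co2 q.
Proof.
transitivity (dot xi xi * dot (p - x) (perp (q - x))); first by rewrite xi1 mul1r.
by rewrite /co1 /co2 !dotE !perp0 !perp1; ring.
Qed.

Lemma eq_co a b : co1 a = co1 b -> co2 a = co2 b -> a = b.
Proof.
move=> h1 h2; apply/subr0_eq/dot_eq0; rewrite dist_co h1 h2; ring.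
Qed.

End Frame.

(** * Euclidean balls and the library topology *)

Lemma mem_eball x r : 0 < r -> eball x r x.
Proof. by move=> r0; rewrite /eball/= subrr -(scale0r 0) enormZ normr0 mul0r. Qed.

Lemma ball_rV2 (u v : 'rV[R]_2) (e : R) : 0 < e ->
  (ball u e v <-> `|u 0 0 - v 0 0| < e /\ `|u 0 1 - v 0 1| < e).
Proof.
move=> e0; split=> [[_ H]|[H0 H1]]; first by split; apply: H.
split=> // i j; rewrite (ord1 i).
case: j => -[|[|//]] j2; rewrite /ball /=.
  by rewrite (_ : Ordinal j2 = 0)//; apply/val_inj.
by rewrite (_ : Ordinal j2 = 1)//; apply/val_inj.
Qed.

(** Library balls are squares: a disk lies in the square of the same radius, and the square of
    radius [r / 2] lies in the disk of radius [r]. *)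
Lemma nbhs_eballP x (A : set 'rV[R]_2) :
  nbhs x A <-> exists r : R, 0 < r /\ eball x r `<=` A.
Proof.
split=> [/nbhs_ballP[e /= e0 eA]|[r [r0 rA]]].
  exists e; split => // z zx; apply: eA; apply/ball_rV2 => //.
  have: dot (z - x) (z - x) < e ^+ 2 by rewrite -enorm_ltE ?ltW.
  rewrite dotE !mxE => H.
  split; rewrite -ltr_sqr ?nnegrE// ?ltW// real_normK ?num_real//.
    have := sqr_ge0 (z 0 1 - x 0 1); nra.
  have := sqr_ge0 (z 0 0 - x 0 0); nra.
apply/nbhs_ballP; exists (r / 2) => /=; first by rewrite divr_gt0.
move=> z /ball_rV2 []; first by rewrite divr_gt0.
move=> H0 H1; apply: rA; rewrite /eball /= enorm_ltE ?ltW// dotE !mxE.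
have r20 : 0 <= r / 2 by rewrite divr_ge0// ?ltW.
have S a : `|a| < r / 2 -> a * a < r / 2 * (r / 2).
  by move=> ar; rewrite -expr2 -real_normK ?num_real// expr2 ltr_pM.
move: (S _ H0) (S _ H1); nra.
Qed.

Lemma nbhs_eball x r : 0 < r -> nbhs x (eball x r).
Proof. by move=> r0; apply/nbhs_eballP; exists r; split. Qed.

Lemma open_eball x r : open (eball x r).
Proof.
rewrite openE => z /= zx; apply/nbhs_eballP.
exists (r - enorm (z - x)); split; first by rewrite subr_gt0.
move=> w /= wz; rewrite /eball /=.
by apply: le_lt_trans (enorm_triangle z _ _) _; rewrite -ltrBrDr.
Qed.

Lemma cvg_enormP (u : nat -> 'rV[R]_2) x :
  u n @[n --> \oo] --> x <->
  forall e : R, 0 < e -> \forall n \near \oo, enorm (u n - x) < e.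
Proof.
split=> [ux e e0|H A /nbhs_eballP[r [r0 rA]]].
  exact: (ux _ (nbhs_eball x e0)).
by apply: filterS (H _ r0) => n /= un; exact: rA.
Qed.

Lemma continuous_dotl (v : 'rV[R]_2) : continuous (fun u => dot u v).
Proof.
move=> u A; rewrite -nbhs_ballE => -[e /= e0 eA].
apply/nbhs_eballP; have v1 : 0 < enorm v + 1.
  by rewrite ltr_wpDl ?enorm_ge0.
exists (e / (enorm v + 1)); split; first by rewrite divr_gt0.
move=> w /=; rewrite /eball/= ltr_pdivlMr// => H; apply: eA.
rewrite /ball /= -dotBl; apply: le_lt_trans (cauchy_schwarz _ _) _.
rewrite enormB; apply: le_lt_trans H; rewrite ler_wpM2l ?enorm_ge0//.
by rewrite ler_wpDr.
Qed.

Lemma continuous_enorm : continuous (@enorm R).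
Proof.
move=> u A; rewrite -nbhs_ballE => -[e /= e0 eA].
apply/nbhs_eballP; exists e; split => // w /=; rewrite /eball /= => H.
apply: eA; rewrite /ball /= ltr_norml.
have := enorm_triangle u w 0; have := enorm_triangle w u 0.
rewrite !subr0 (enormB u w) => ? ?; apply/andP; split; lra.
Qed.

Lemma continuous_subr x : continuous (fun z : 'rV[R]_2 => z - x).
Proof.
move=> u A /nbhs_eballP[r [r0 rA]]; apply/nbhs_eballP; exists r; split => //.
by move=> w H; apply: rA; move: H; rewrite /eball /= opprB addrA subrK.
Qed.

Lemma continuous_co1 x xi : continuous (co1 x xi).
Proof.
move=> z; apply: (@continuous_comp _ _ _ (fun z => z - x) (fun u => dot u xi)).
  exact: continuous_subr.
exact: continuous_dotl.
Qed.
Lemma continuous_co2 x xi : continuous (co2 x xi).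
Proof. exact: (@continuous_co1 x (perp xi)). Qed.

Lemma continuous_dist x : continuous (fun z => enorm (z - x)).
Proof.
move=> z; apply: (@continuous_comp _ _ _ (fun z => z - x) (@enorm R)).
  exact: continuous_subr.
exact: continuous_enorm.
Qed.

(** * Compactness in the plane *)

Lemma compact_max (A : set 'rV[R]_2) (f : 'rV[R]_2 -> R) :
  compact A -> A !=set0 -> continuous f ->
  exists2 c, A c & forall t, A t -> f t <= f c.
Proof.
move=> cA A0 cf.
have [|c cA' H] := EVT_max_rV A0 cA (f := f).
  exact: continuous_subspaceT.
by exists c; [rewrite -inE|move=> t tA; apply: H; rewrite inE].
Qed.

Lemma compact_min (A : set 'rV[R]_2) (f : 'rV[R]_2 -> R) :
  compact A -> A !=set0 -> continuous f ->
  exists2 c, A c & forall t, A t -> f c <= f t.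
Proof.
move=> cA A0 cf.
have [|c cA' H] := EVT_min_rV A0 cA (f := f).
  exact: continuous_subspaceT.
by exists c; [rewrite -inE|move=> t tA; apply: H; rewrite inE].
Qed.

(** The distance attains its minimum. The gap [h] ensures that no point of [A] covers anything
    within distance [h] of [z], which is how parts of [E] are discarded near a given point. *)
Lemma compact_dist_gap (A : set 'rV[R]_2) z (e : R) :
  compact A -> (forall p, A p -> e < enorm (p - z)) ->
  exists2 h : R, 0 < h & forall p, A p -> e + h <= enorm (p - z).
Proof.
move=> cA H; have [->|/set0P A0] := eqVneq A set0; first by exists 1.
have [c Ac cP] := compact_min cA A0 (@continuous_dist z).
exists (enorm (c - z) - e); first by rewrite subr_gt0 H.
by move=> p /cP; lra.
Qed.

Lemma compact_closed_rV (A : set 'rV[R]_2) : compact A -> closed A.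
Proof. by apply: compact_closed; exact: norm_hausdorff. Qed.

Lemma compact_setI_le (A : set 'rV[R]_2) (f : 'rV[R]_2 -> R) (c : R) :
  compact A -> continuous f -> compact (A `&` [set p | f p <= c]).
Proof.
move=> cA cf; apply: compact_closedI => //.
have := @preimage_closed _ _ f [set y | y <= c]; apply; last exact: closed_le.
by move=> z _; exact: cf.
Qed.

Lemma compact_setI_ge (A : set 'rV[R]_2) (f : 'rV[R]_2 -> R) (c : R) :
  compact A -> continuous f -> compact (A `&` [set p | c <= f p]).
Proof.
move=> cA cf; apply: compact_closedI => //.
have := @preimage_closed _ _ f [set y | c <= y]; apply; last exact: closed_ge.
by move=> z _; exact: cf.
Qed.

Lemma compact_closed_eball x (d : R) : compact [set z | enorm (z - x) <= d].
Proof.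
apply: bounded_closed_compact.
  exists (d + `|x|); split; rewrite ?num_real// => M dM z /= zx.
  rewrite -(subrK x z); apply: le_trans (ler_normD _ _) _.
  apply: ltW; apply: le_lt_trans dM; rewrite lerD2r; apply: le_trans zx.
  rewrite /Num.norm /= mx_normrE; apply/bigmax_leP; split; first exact: enorm_ge0.
  move=> [i j] _ /=; rewrite (ord1 i).
  rewrite -ler_sqr ?nnegrE ?enorm_ge0// real_normK ?num_real// sqr_enorm.
  exact: sqr_coord_le.
have := @preimage_closed _ _ (fun z => enorm (z - x)) [set y | y <= d]; apply.
  by move=> z _; exact: continuous_dist.
exact: closed_le.
Qed.

Lemma continuous_pt x xi (f g : R -> R) : dot xi xi = 1 ->
  continuous f -> continuous g -> continuous (fun r => pt x xi (f r) (g r)).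
Proof.
move=> xi1 cf cg r A /nbhs_eballP[e [e0 eA]].
have e20 : 0 < e / 2 by rewrite divr_gt0.
have Hf : \forall r' \near r, `|f r - f r'| < e / 2.
  by move/cvgrPdist_lt: (cf r); apply.
have Hg : \forall r' \near r, `|g r - g r'| < e / 2.
  by move/cvgrPdist_lt: (cg r); apply.
apply: filterS2 Hf Hg => r' fr gr; apply: eA; rewrite /eball /=.
rewrite enorm_ltE ?(ltW e0)// (dist_co x xi1) !co1_pt// !co2_pt//.
have S a b : `|a - b| < e / 2 -> (b - a) ^+ 2 < e / 2 * (e / 2).
  move=> ab; rewrite -real_normK ?num_real// expr2 distrC.
  by rewrite ltr_pM.
have := S _ _ fr; have := S _ _ gr; nra.
Qed.

End Plane.

(** * Neighbourhoods and outward directions *)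

Section Neighbourhood.
Variables (R : realType) (E : set 'rV[R]_2) (eps : R).
Hypotheses (cE : compact E) (eps0 : 0 < eps).
Implicit Types (u v w x y z p xi : 'rV[R]_2).

Local Notation N := (nbhd E eps).
Local Notation dN := (boundary (nbhd E eps)).

(** For compact [E] this is the complement of [nbhd], written with distances only; [not_nbhdP]
    proves the equivalence. *)
Definition outside u := forall p, E p -> eps < enorm (p - u).

Lemma outside_or u : outside u \/ exists p, E p /\ enorm (p - u) <= eps.
Proof.
have [|h] := pselect (exists p, E p /\ enorm (p - u) <= eps); first by right.
left=> p Ep; rewrite ltNge; apply/negP => pu; apply: h; by exists p.
Qed.

Lemma nbhdP z : N z <-> exists p, E p /\ enorm (p - z) <= eps.
Proof.
split=> [Nz|[p [Ep pz]]].
  have [oz|//] := outside_or z.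
  have [h h0 H] := compact_dist_gap cE oz.
  have [w [[p Ep /= pw] /= wz]] := Nz _ (nbhs_eball z h0).
  have := H _ Ep; have := enorm_triangle w p z.
  rewrite /eball /= in pw wz; rewrite (enormB p w); lra.
move=> B /nbhs_eballP[r [r0 rB]].
(* Moving [z] towards [p] by the fraction [k] enters the open ball around [p], and [k * eps < r]
   keeps the point near [z]. *)
have [k [k0 k1 kr]] : exists k : R, [/\ 0 < k, k < 1 & k * eps < r].
  exists (Num.min (1 / 2) (r / (2 * eps))); split.
  - by rewrite lt_min; apply/andP; split; rewrite divr_gt0// mulr_gt0.
  - by rewrite gt_min; apply/orP; left; lra.
  - have e2 : r / (2 * eps) * eps = r / 2.
      by field; rewrite gt_eqF.
    apply: (@le_lt_trans _ _ (r / 2)); last by lra.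
    by rewrite -e2 (ler_wpM2r (ltW eps0))// ge_min lexx orbT.
exists (z + k *: (p - z)); split.
  exists p => //; rewrite /eball /=.
  have -> : z + k *: (p - z) - p = (k - 1) *: (p - z).
    by apply/rowP => i; rewrite !mxE; ring.
  rewrite enormZ ltr0_norm ?subr_lt0// opprB.
  have : (1 - k) * enorm (p - z) <= (1 - k) * eps by rewrite ler_wpM2l//; lra.
  have : 0 < k * eps by rewrite mulr_gt0.
  lra.
apply: rB; rewrite /eball /= addrC addKr enormZ gtr0_norm//.
by apply: le_lt_trans kr; rewrite ler_wpM2l// ltW.
Qed.

Lemma not_nbhdP z : ~ N z <-> outside z.
Proof.
split=> [nN|oz /nbhdP[p [/oz]]].
  by have [//|/nbhdP] := outside_or z.
by rewrite ltNge => /negP.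
Qed.

Lemma closed_nbhd : closed N.
Proof. exact: closed_closure. Qed.

Lemma boundaryP z : dN z <-> (exists p, E p /\ enorm (p - z) <= eps) /\
  forall h : R, 0 < h -> exists u, outside u /\ enorm (u - z) < h.
Proof.
split=> [[cz iz]|[/nbhdP Nz H]].
  split; first by apply/nbhdP; exact: closed_nbhd.
  move=> h h0; apply: contrapT => nu; apply: iz; apply/nbhs_eballP; exists h.
  split => // w wz; apply: contrapT => /not_nbhdP ow; apply: nu; by exists w.
split; first exact: subset_closure.
move=> /nbhs_eballP[r [r0 rN]].
by have [u [/not_nbhdP ou uz]] := H _ r0; apply/ou/rN.
Qed.

Lemma boundary_dist z p : dN z -> E p -> eps <= enorm (p - z).
Proof.
move=> /boundaryP[_ H] Ep; rewrite leNgt; apply/negP => pz.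
have [|u [ou uz]] := H (eps - enorm (p - z)); first by rewrite subr_gt0.
have := ou _ Ep; have := enorm_triangle z p u; rewrite (enormB z u); lra.
Qed.

(** A point of [E] at distance [eps] from [z] cannot be interior to [E]: its translate by [u - z],
    for an outside point [u] near [z], is at distance exactly [eps] from [u]. *)
Lemma contributorsP z y : dN z ->
  contributors E eps z y <-> E y /\ enorm (y - z) = eps.
Proof.
move=> bz; split=> -[].
  by case=> /(compact_closed_rV cE) Ey _ yz; split.
move=> Ey yz; split => //; split; first exact: subset_closure.
move=> /nbhs_eballP[r [r0 rE]].
have /boundaryP[_ /(_ (Num.min r eps))[|u [ou]]] := bz; first by rewrite lt_min r0.
rewrite lt_min => /andP[ur ue].
have /ou : E (y + (u - z)) by apply: rE; rewrite /eball /= addrC addKr.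
suff -> : y + (u - z) - u = y - z by rewrite yz ltxx.
by apply/rowP => i; rewrite !mxE; ring.
Qed.

Lemma contributor_exists z : dN z -> exists y, contributors E eps z y.
Proof.
move=> bz; have /boundaryP[[p [Ep pz]] _] := bz.
exists p; apply/contributorsP => //; split => //.
by apply/eqP; rewrite eq_le pz boundary_dist.
Qed.

Lemma boundary_dist_gt z p : dN z -> E p -> ~ contributors E eps z p ->
  eps < enorm (p - z).
Proof.
move=> bz Ep np; rewrite lt_def boundary_dist// andbT; apply/eqP => pz.
by apply: np; apply/contributorsP.
Qed.

Lemma two_contributors_singular z y1 y2 : dN z -> contributors E eps z y1 ->
  contributors E eps z y2 -> y1 <> y2 -> singularities E eps z.
Proof.
move=> bz c1 c2 ne; split => // -[_ [r [r0 H]]].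
have [|_ [y yP]] := H z; first by split => //; exact: mem_eball.
by apply: ne; move: c1 c2; rewrite yP => -> ->.
Qed.

Lemma outwardP x xi : dN x -> (outward_directions E eps x xi <-> enorm xi = 1 /\
  forall h : R, 0 < h -> exists u, [/\ outside u, enorm (u - x) < h &
    enorm ((enorm (u - x))^-1 *: (u - x) - xi) < h]).
Proof.
move=> bx; split=> -[xi1].
  move=> [u [nu /cvg_enormP ux /cvg_enormP ud]]; split => // h h0.
  have [n [H1 H2]] := filter_ex (filterI (ux _ h0) (ud _ h0)).
  by exists (u n); split => //; exact/not_nbhdP.
move=> H; split => //.
have /choice[u uP] : forall n : nat, exists u, [/\ outside u,
    enorm (u - x) < n.+1%:R^-1 &
    enorm ((enorm (u - x))^-1 *: (u - x) - xi) < n.+1%:R^-1].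
  by move=> n; apply: H; rewrite invr_gt0.
have nearE (e : R) : 0 < e -> \forall n \near \oo, n.+1%:R^-1 < e.
  by move=> e0; near=> n; near: n; exact: near_infty_natSinv_lt (PosNum e0).
exists u; split.
- by move=> n; apply/not_nbhdP; have [] := uP n.
- apply/cvg_enormP => e /nearE; apply: filterS => n; apply: lt_trans.
  by have [] := uP n.
- apply/cvg_enormP => e /nearE; apply: filterS => n; apply: lt_trans.
  by have [] := uP n.
Unshelve. all: by end_near. Qed.

(** If [y] were ahead of [xi], outside points leaving [x] nearly along [xi] would come closer to [y]
    than [eps]. *)
Lemma outward_le x xi y : dN x -> outward_directions E eps x xi ->
  contributors E eps x y -> dot (y - x) xi <= 0.
Proof.
move=> bx /(outwardP _ bx)[xi1 H] /(contributorsP _ bx)[Ey yx].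
rewrite leNgt; apply/negP; set c := dot _ _ => c0.
(* With this [h] the unit direction [w] of [u - x] still has scalar product above [c / 2] with
   [y - x], and [u] is so near that the term linear in [enorm (u - x)] beats the quadratic one. *)
pose h := Num.min (c / 2) (c / 2 / eps).
have h0 : 0 < h by rewrite lt_min !divr_gt0.
have [u [ou]] := H _ h0.
rewrite lt_min => /andP[uc _]; set w := _ *: _; rewrite lt_min => /andP[_ wxi].
have ux0 : 0 < enorm (u - x).
  rewrite lt_def enorm_ge0 andbT; apply/eqP => /enorm_eq0/subr0_eq ux.
  by have := ou _ Ey; rewrite ux yx ltxx.
have uw : u - x = enorm (u - x) *: w.
  by rewrite /w scalerA divff ?gt_eqF// scale1r.
have yw : c / 2 < dot (y - x) w.
  have := cauchy_schwarz (y - x) (w - xi); rewrite yx dotBr -/c.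
  move: wxi; rewrite ltr_pdivlMr// mulrC => wxi.
  rewrite ler_norml => /andP[]; lra.
have := ou _ Ey; rewrite ltNge => /negP; apply.
rewrite enorm_leE; last exact: ltW.
have -> : y - u = (y - x) - (u - x) by rewrite opprB addrA subrK.
have : dot (y - x) (u - x) = enorm (u - x) * dot (y - x) w.
  by rewrite [in LHS]uw dotZr.
move: yx yw uc ux0; set a := y - x; set b := u - x => yx yw uc ux0 ab.
rewrite dot_sqrB ab -!sqr_enorm yx.
nra.
Qed.

Definition dir x u : 'rV[R]_2 := (enorm (u - x))^-1 *: (u - x).

Lemma enorm_dir x u : u <> x -> enorm (dir x u) = 1.
Proof.
move=> ux; have n0 : 0 < enorm (u - x) by rewrite enorm_gt0 subr_eq0; exact/eqP.
by rewrite /dir enormZ gtr0_norm ?invr_gt0// mulVf// gt_eqF.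
Qed.

Lemma outside_boundary_neq x u : dN x -> outside u -> u <> x.
Proof.
by move=> /boundaryP[[p [Ep pz]] _] ou ux; have := ou _ Ep; rewrite ux ltNge pz.
Qed.

Lemma compact_unit_circle : compact [set xi : 'rV[R]_2 | enorm xi = 1].
Proof.
have -> : [set xi : 'rV[R]_2 | enorm xi = 1] =
    [set xi | enorm (xi - 0) <= 1] `&` [set xi | 1 <= enorm xi].
  apply/seteqP; split=> xi /=; rewrite subr0; first by move=> ->.
  by case=> ? ?; apply/eqP; rewrite eq_le; apply/andP; split.
apply: compact_setI_ge; first exact: compact_closed_eball.
exact: continuous_enorm.
Qed.

(** The unit circle is compact, so the directions of outside points tending to [x] have a cluster
    point. *)
Lemma outward_exists x : dN x -> exists xi, outward_directions E eps x xi.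
Proof.
move=> bx.
have cx : closure outside x.
  move=> B /nbhs_eballP[r [r0 rB]].
  have /boundaryP[_ /(_ _ r0)[u [ou ux]]] := bx.
  by exists u; split => //; apply: rB.
have PF := within_nbhs_proper cx.
have [|xi [xi1 xiC]] := @compact_unit_circle (dir x @ within outside (nbhs x)) _.
  have : within outside (nbhs x) outside by exact: withinT.
  apply: filterS => u ou; exact: enorm_dir (outside_boundary_neq bx ou).
exists xi; apply/outwardP => //; split => // h h0.
pose A := dir x @` [set u | outside u /\ enorm (u - x) < h].
have [|w [[u [ou ux] <-] wxi]] := xiC A _ _ (nbhs_eball xi h0);
  last by exists u; split.
have H : within outside (nbhs x) (eball x h).
  by apply: (cvg_within _ (nbhs_eball x h0)).
apply: filterS (filterI H (withinT _ _)) => u [ux ou].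
by exists u.
Qed.

(** Points of [E] behind [v] recede when one moves along [v]; those ahead are not contributors,
    hence are farther than [eps] by a uniform gap. *)
Lemma exit_direction x v : dN x ->
  (forall y, contributors E eps x y -> dot (y - x) v < 0) ->
  exists2 t0 : R, 0 < t0 & forall t, 0 < t -> t < t0 -> outside (x + t *: v).
Proof.
move=> bx H.
have cK := compact_setI_ge (c := 0) cE (@continuous_co1 _ x v).
have [|h h0 hK] := @compact_dist_gap _ _ x eps cK.
  move=> p [Ep /= p0]; apply: boundary_dist_gt => // /H.
  by rewrite /co1 in p0; rewrite ltNge p0.
(* Until this time the displacement is below the gap [h]; the summand 1 makes the denominator
   positive. *)
exists (h / (enorm v + 1)); first by rewrite divr_gt0// ltr_wpDl ?enorm_ge0.
move=> t t0; rewrite ltr_pdivlMr ?ltr_wpDl ?enorm_ge0// => th p Ep.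
have [p0|p0] := leP 0 (dot (p - x) v).
  have := hK p (conj Ep p0); have := enorm_triangle (x + t *: v) p x.
  rewrite [x + _ - x]addrC addKr enormZ gtr0_norm//; lra.
rewrite -ltr_sqr ?nnegrE ?enorm_ge0 ?ltW// sqr_enorm.
have -> : p - (x + t *: v) = (p - x) - t *: v by rewrite opprD addrA.
rewrite dot_sqrB !dotZl !dotZr -sqr_enorm.
have := boundary_dist bx Ep; have := dot_ge0 v.
set a := dot v v; set b := dot _ v; set d := enorm _ => a0 ed.
have : eps ^+ 2 <= d ^+ 2 by rewrite ler_sqr ?nnegrE /d ?enorm_ge0 ?(ltW eps0).
have : 0 < t * - b by rewrite mulr_gt0 ?oppr_gt0.
have : 0 <= t * (t * a) by rewrite !mulr_ge0// ltW.
nra.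
Qed.

(** Normalizing moves [v] by the distance of its norm from 1, which is at most [enorm (v - xi)]. *)
Lemma enorm_normalize v xi : v != 0 -> enorm xi = 1 ->
  enorm ((enorm v)^-1 *: v - xi) <= 2 * enorm (v - xi).
Proof.
move=> v0 xi1; have n0 : 0 < enorm v by rewrite enorm_gt0.
have := enorm_triangle v ((enorm v)^-1 *: v) xi.
have -> : (enorm v)^-1 *: v - v = ((enorm v)^-1 - 1) *: v by rewrite scalerBl scale1r.
rewrite enormZ -[X in _ * X + _](gtr0_norm n0) -normrM mulrBl mulVf ?gt_eqF// mul1r.
have : `|1 - enorm v| <= enorm (v - xi).
  rewrite ler_norml; apply/andP; split.
    have := enorm_triangle xi v 0; rewrite !subr0 xi1; lra.
  have := enorm_triangle v xi 0; rewrite !subr0 xi1 (enormB xi); lra.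
lra.
Qed.

(** Tilting [xi] slightly towards [v] makes all scalar products strictly negative, so [xi] is a
    limit of exit directions. *)
Lemma outward_limit x xi v : dN x -> enorm xi = 1 ->
  (forall y, contributors E eps x y -> dot (y - x) v < 0) ->
  (forall y, contributors E eps x y -> dot (y - x) xi <= 0) ->
  outward_directions E eps x xi.
Proof.
move=> bx xi1 Hv Hxi; apply/outwardP => //; split => // h h0.
have v1 : 0 < 2 * enorm v + 1 by rewrite ltr_wpDl// mulr_ge0 ?enorm_ge0.
(* After normalization the tilt costs at most [2 * k * enorm v], which is below [h]. *)
pose k := h / (2 * enorm v + 1).
have k0 : 0 < k by rewrite divr_gt0.
have kh : k * (2 * enorm v + 1) = h by rewrite divfK ?gt_eqF.
pose w := xi + k *: v.
have Hw y : contributors E eps x y -> dot (y - x) w < 0.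
  move=> cy; rewrite dotDr dotZr; have := Hv _ cy; have := Hxi _ cy; nra.
have w0 : w != 0.
  have [y cy] := contributor_exists bx; apply/eqP => w0.
  by have := Hw _ cy; rewrite w0 dotE !mxE !mulr0 addr0 ltxx.
have nw0 : 0 < enorm w by rewrite enorm_gt0.
have [t0 t00 Ht] := exit_direction bx Hw.
pose t := Num.min (t0 / 2) (h / enorm w / 2).
have t_gt0 : 0 < t by rewrite lt_min !divr_gt0.
exists (x + t *: w); split.
- by apply: Ht => //; rewrite gt_min; apply/orP; left; lra.
- rewrite [x + _ - x]addrC addKr enormZ gtr0_norm// -ltr_pdivlMr//.
  rewrite gt_min; apply/orP; right; have : 0 < h / enorm w by rewrite divr_gt0.
  lra.
- rewrite [x + _ - x]addrC addKr enormZ gtr0_norm// invfM scalerA.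
  rewrite mulrAC mulVf ?gt_eqF// mul1r.
  apply: le_lt_trans (enorm_normalize w0 xi1) _.
  rewrite [w]addrC addrK enormZ gtr0_norm// -kh; lra.
Qed.

End Neighbourhood.

(** * Extremal directions and contributors *)

Section LeftArc.
Variable R : realFieldType.

(** Going down the left half circle is a counterclockwise turn by at most a half turn, which fixes
    the sign of the cross product. *)
Lemma arc_cross (a1 a2 b1 b2 : R) : a1 <= 0 -> b1 <= 0 ->
  a1 ^+ 2 + a2 ^+ 2 = b1 ^+ 2 + b2 ^+ 2 -> b2 <= a2 ->
  b1 * a2 - b2 * a1 <= 0.
Proof.
move=> a10 b10 nn ba.
have [b20|b20] := leP b2 0; last first.
  have b1a1 : b1 <= a1 by nra.
  nra.
have [a20|a20] := leP 0 a2; first by nra.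
have b1a1 : a1 <= b1 by nra.
nra.
Qed.

(** Parallel vectors of equal norm are equal or opposite, and opposite vectors of a closed half
    plane lie on its boundary line. *)
Lemma arc_cross_eq0 (a1 a2 b1 b2 : R) : a1 <= 0 -> b1 <= 0 ->
  a1 ^+ 2 + a2 ^+ 2 = b1 ^+ 2 + b2 ^+ 2 -> b1 * a2 - b2 * a1 = 0 ->
  (a1 = b1 /\ a2 = b2) \/ (a1 = 0 /\ b1 = 0).
Proof.
move=> a10 b10 nn /eqP; rewrite subr_eq0 => /eqP cr.
have sq : (a1 ^+ 2 - b1 ^+ 2) * (a1 ^+ 2 + a2 ^+ 2) = 0.
  rewrite [X in _ * X]nn (_ : _ * _ = a1 ^+ 2 * (b1 ^+ 2 + b2 ^+ 2) -
    b1 ^+ 2 * (b1 ^+ 2 + b2 ^+ 2)); last by ring.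
  rewrite -[X in _ - _ * X]nn mulrDr [X in _ - X]mulrDr.
  have -> : a1 ^+ 2 * b2 ^+ 2 = (b2 * a1) ^+ 2 by ring.
  have -> : b1 ^+ 2 * a2 ^+ 2 = (b1 * a2) ^+ 2 by ring.
  rewrite cr; ring.
move/eqP: sq; rewrite mulf_eq0 => /orP[|/eqP aa0].
  rewrite subr_eq0 eqf_sqr => /orP[] /eqP ab; last first.
    by right; split; lra.
  have [b10'|b1n] := eqVneq b1 0; first by right; rewrite ab.
  left; split => //; apply: (mulfI b1n); rewrite cr ab; ring.
right; have := sqr_ge0 a2; have := sqr_ge0 b2 => ? ?.
have a1z : a1 ^+ 2 = 0 by apply/eqP; rewrite eq_le sqr_ge0; lra.
have b1z : b1 ^+ 2 = 0 by apply/eqP; rewrite eq_le sqr_ge0; lra.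
by split; apply/eqP; rewrite -sqrf_eq0; apply/eqP.
Qed.

(** With [c] above [d] above [e] on the half circle, the angle from [c] to [e] is at least that from
    [d] to [e]. *)
Lemma arc_dot (c1 c2 d1 d2 e1 e2 : R) : c1 <= 0 -> d1 <= 0 -> e1 <= 0 ->
  c1 ^+ 2 + c2 ^+ 2 = d1 ^+ 2 + d2 ^+ 2 ->
  d1 ^+ 2 + d2 ^+ 2 = e1 ^+ 2 + e2 ^+ 2 -> e2 <= d2 -> d2 <= c2 ->
  c1 * e1 + c2 * e2 <= d1 * e1 + d2 * e2.
Proof.
move=> c10 d10 e10 cd de ed dc.
have ce : c1 ^+ 2 + c2 ^+ 2 = e1 ^+ 2 + e2 ^+ 2 by rewrite cd.
have h1 := arc_cross d10 e10 de ed.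
have h2 := arc_cross c10 e10 ce (le_trans ed dc).
have [s0|s0] := eqVneq (c1 + d1) 0.
  have c1z : c1 = 0 by lra.
  have d1z : d1 = 0 by lra.
  move: cd de; rewrite c1z d1z !mul0r expr0n !add0r => /eqP.
  rewrite eqf_sqr => /orP[] /eqP c2E _; rewrite c2E // in dc *; nra.
have sn : c1 + d1 < 0 by rewrite lt_def eq_sym s0; lra.
(* After multiplication by [c1 + d1], the difference factors into [c2 - d2] and a sum of two cross
   products of known sign. *)
rewrite -subr_ge0 -(nmulr_rle0 _ sn).
have -> : (c1 + d1) * (d1 * e1 + d2 * e2 - (c1 * e1 + c2 * e2)) =
  (d1 ^+ 2 - c1 ^+ 2) * e1 + (c1 + d1) * (d2 - c2) * e2 by ring.
have -> : d1 ^+ 2 - c1 ^+ 2 = (c2 - d2) * (c2 + d2) by rewrite -subr_sqr; lra.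
have -> : (c2 - d2) * (c2 + d2) * e1 + (c1 + d1) * (d2 - c2) * e2 =
  (c2 - d2) * ((e1 * c2 - e2 * c1) + (e1 * d2 - e2 * d1)) by ring.
by rewrite mulr_ge0_le0 ?subr_ge0//; lra.
Qed.
End LeftArc.

Section Extremal.
Variables (R : realType) (E : set 'rV[R]_2) (eps : R).
Hypotheses (cE : compact E) (eps0 : 0 < eps).
Implicit Types u v w x y z p xi : 'rV[R]_2.

Local Notation dN := (boundary (nbhd E eps)).
Local Notation Ctr := (contributors E eps).

Lemma compact_contributors z : dN z -> compact (Ctr z).
Proof.
move=> bz.
have -> : Ctr z = E `&` [set p | enorm (p - z) <= eps].
  apply/seteqP; split=> p; first by move=> /(contributorsP cE eps0 _ bz)[Ep /= ->].
  move=> [Ep /= pz]; apply/(contributorsP cE eps0 _ bz); split=> //.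
  by apply/eqP; rewrite eq_le pz (boundary_dist cE eps0 bz).
exact: compact_setI_le cE (@continuous_dist _ z).
Qed.

(** In the antipodal case [- xi] may or may not be outward; this is left open because it separates
    the one-sided types from the two-sided ones. *)
Inductive extremal_spec z (a b : 'rV[R]_2) : Prop :=
| SingleContributor xi of a = b & Ctr z = [set a] & dot xi xi = 1 &
    dot (a - z) xi = 0 & extremal_directions E eps z = [set xi; - xi]
| ObliqueContributors xi1 xi2 of a <> b & xi1 <> xi2 & xi1 <> - xi2 &
    extremal_directions E eps z = [set xi1; xi2]
| AntipodalContributors xi of dot xi xi = 1 & outward_directions E eps z xi &
    a = z + eps *: perp xi & b = z - eps *: perp xi &
    extremal_directions E eps z = outward_directions E eps z &
    (forall xi', outward_directions E eps z xi' -> xi' = xi \/ xi' = - xi).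

(** In the frame of an outward direction all contributors lie on a left half circle, and [a] and [b]
    are its highest and lowest ones. The minimality of their scalar product later bounds the angle
    at members of a chain. *)
Lemma extremal_structure z : dN z -> exists a b, [/\ Ctr z a, Ctr z b,
  extremal_contributors E eps z = [set a; b],
  (forall p q, Ctr z p -> Ctr z q ->
    dot (a - z) (b - z) <= dot (p - z) (q - z)) & extremal_spec z a b].
Proof.
move=> bz; have [xi0 xi0o] := outward_exists cE eps0 bz.
have cC := compact_contributors bz.
have C0 := contributor_exists cE eps0 bz.
have xi01 : dot xi0 xi0 = 1.
  by case: xi0o => xi1 _; rewrite -sqr_enorm xi1 expr1n.
have [a Ca aM] := compact_max cC C0 (@continuous_co2 _ z xi0).
have [b Cb bm] := compact_min cC C0 (@continuous_co2 _ z xi0).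
pose c1 := co1 z xi0; pose c2 := co2 z xi0.
have c1le p : Ctr z p -> c1 p <= 0.
  exact: outward_le.
have cdist p : Ctr z p -> c1 p ^+ 2 + c2 p ^+ 2 = eps ^+ 2.
  move=> /(contributorsP cE eps0 _ bz)[_ pz].
  by rewrite /c1 /c2 -dist_co_x// -sqr_enorm pz.
have ceq p q : Ctr z p -> Ctr z q -> c1 p ^+ 2 + c2 p ^+ 2 = c1 q ^+ 2 + c2 q ^+ 2.
  by move=> /cdist -> /cdist ->.
(* The cross product orders the contributors along the half circle. *)
pose X p q := dot (p - z) (perp (q - z)).
have XE p q : X p q = c2 p * c1 q - c1 p * c2 q by exact: cross_co.
have XC p q : X p q = - X q p by rewrite !XE; ring.
have Xxx p : X p p = 0 by rewrite /X dot_perp.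
have Xle p q : Ctr z p -> Ctr z q -> c2 q <= c2 p -> X p q <= 0.
  move=> Cp Cq qp; have := arc_cross (c1le _ Cp) (c1le _ Cq) (ceq _ _ Cp Cq) qp.
  rewrite XE; lra.
have X0 p q : Ctr z p -> Ctr z q -> X p q = 0 -> p = q \/ (c1 p = 0 /\ c1 q = 0).
  move=> Cp Cq; rewrite XE => pq0.
  have [|[h1 h2]|] := arc_cross_eq0 (c1le _ Cp) (c1le _ Cq) (ceq _ _ Cp Cq).
  - lra.
  - by left; apply: (eq_co xi01 h1 h2).
  - by right.
have c1_eq0 p : Ctr z p -> c1 p = 0 -> c2 p = eps \/ c2 p = - eps.
  move=> /cdist + p0; rewrite p0 expr0n add0r => /eqP; rewrite eqf_sqr.
  by case/orP => /eqP; [left|right].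
have c2_eps p : Ctr z p -> c2 p ^+ 2 = eps ^+ 2 -> c1 p = 0.
  by move=> /cdist + h; rewrite h => H; apply/eqP; rewrite -sqrf_eq0; apply/eqP; lra.
have c2_bound p : Ctr z p -> - eps <= c2 p <= eps.
  move=> /cdist h; rewrite -ler_norml -ler_sqr ?nnegrE ?(ltW eps0)//
    real_normK ?num_real//.
  have := sqr_ge0 (c1 p); lra.
(* Up to sign, the only unit vector orthogonal to [y - z], hence the only candidate for a direction
   at which [y] is extremal. *)
pose tang y := eps^-1 *: perp (y - z).
have dtang p q : dot (p - z) (tang q) = eps^-1 * X p q by rewrite dotZr.
have epsV0 : 0 < eps^-1 by rewrite invr_gt0.
have tangN p : Ctr z p -> dot (tang p) (tang p) = 1.
  move=> /(contributorsP cE eps0 _ bz)[_ pz].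
  rewrite /tang dotZl dotZr dot_perp_perp -sqr_enorm pz.
  by field; rewrite gt_eqF.
have tangU xi p : outward_directions E eps z xi -> Ctr z p ->
    dot (p - z) xi = 0 -> xi = tang p \/ xi = - tang p.
  move=> [xi1 _] /(contributorsP cE eps0 _ bz)[_ pz] p0.
  apply: unit_orthogonal => //; first by rewrite -sqr_enorm pz.
  by rewrite -sqr_enorm xi1 expr1n.
have minab p q : Ctr z p -> Ctr z q -> dot (a - z) (b - z) <= dot (p - z) (q - z).
  wlog qp : p q / c2 q <= c2 p.
    move=> H Cp Cq; have [|/ltW] := leP (c2 q) (c2 p) => h; first exact: H.
    by rewrite [leRHS]dotC; exact: H.
  move=> Cp Cq; rewrite !(dot_co z xi01) co1_x co2_x !subr0.
  apply: (@le_trans _ _ (c1 p * c1 b + c2 p * c2 b)).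
    by apply: arc_dot; rewrite ?c1le//; [exact: ceq|exact: ceq|exact: bm|exact: aM].
  (* The angle is widened one end at a time; replacing [q] by [b] is the previous argument reflected
     in the first axis. *)
  have := @arc_dot _ (c1 b) (- c2 b) (c1 q) (- c2 q) (c1 p) (- c2 p).
  rewrite !sqrrN !lerN2 !mulrNN ![_ * c1 p]mulrC ![_ * c2 p]mulrC; apply.
  - exact: c1le.
  - exact: c1le.
  - exact: c1le.
  - exact: ceq.
  - exact: ceq.
  - exact: qp.
  - exact: bm.
have e0 := eps0.
exists a, b.
(* The antipodal case: [a] and [b] are distinct and both on the axis [perp xi0]. *)
have [[a1 b1 ab]|nanti] := pselect [/\ c1 a = 0, c1 b = 0 & c2 a <> c2 b].
  have [a2 b2] : c2 a = eps /\ c2 b = - eps.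
    have := bm _ Ca; rewrite -/c2 => ba.
    case: (c1_eq0 _ Ca a1) => a2; case: (c1_eq0 _ Cb b1) => b2.
    - by case: ab; rewrite a2 b2.
    - by [].
    - by exfalso; lra.
    - by case: ab; rewrite a2 b2.
  have aE : a - z = eps *: perp xi0.
    apply: (addIr z); rewrite subrK addrC; apply: (@eq_co _ z xi0) => //.
      by rewrite -/c1 a1 /c1 /co1 [_ - z]addrC addKr dotZl dot_perpl mulr0.
    by rewrite -/c2 a2 /c2 /co2 [_ - z]addrC addKr dotZl dot_perp_perp xi01 mulr1.
  have bE : b - z = - (eps *: perp xi0).
    apply: (addIr z); rewrite subrK addrC; apply: (@eq_co _ z xi0) => //.
      by rewrite -/c1 b1 /c1 /co1 [_ - z]addrC addKr dotNl dotZl dot_perpl mulr0 oppr0.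
    by rewrite -/c2 b2 /c2 /co2 [_ - z]addrC addKr dotNl dotZl dot_perp_perp xi01 mulr1.
  have orth xi : outward_directions E eps z xi -> dot (perp xi0) xi = 0.
    move=> oxi; have := outward_le cE eps0 bz oxi Ca.
    have := outward_le cE eps0 bz oxi Cb.
    rewrite aE bE dotNl dotZl => h1 h2.
    have /eqP : eps * dot (perp xi0) xi = 0 by lra.
    by rewrite mulf_eq0 gt_eqF//= => /eqP.
  have out2 xi : outward_directions E eps z xi -> xi = xi0 \/ xi = - xi0.
    move=> oxi; have h := orth _ oxi; case: (oxi) => xi1 _.
    have := @unit_orthogonal _ (perp xi0) xi 1 ltr01.
    rewrite dot_perp_perp xi01 expr1n h -sqr_enorm xi1 expr1n invr1 scale1r.
    have -> : perp (perp xi0) = - xi0.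
      apply/subr0_eq/dot_eq0; rewrite opprK dotE !mxE /=; ring.
    by rewrite opprK => /(_ erefl erefl erefl)[]; [right|left].
  split => //.
    apply/seteqP; split => y.
      move=> [Cy [xi [oxi y0]]].
      have y1 : c1 y = 0.
        by case: (out2 _ oxi) y0 => ->; rewrite ?dotNr /c1 /co1 //; lra.
      case: (c1_eq0 _ Cy y1) => y2; [left|right]; apply: (eq_co (x := z) xi01) => //;
        by rewrite -/c1 -/c2 ?y1 ?y2 ?a1 ?b1 ?a2 ?b2.
    by case=> ->; split=> //; exists xi0; split=> //.
  apply: (@AntipodalContributors _ _ _ xi0) => //.
  - by rewrite -aE addrC subrK.
  - by rewrite -bE addrC subrK.
  - apply/seteqP; split=> xi; first by case.
    by move=> oxi; split => //; exists a; split=> //; rewrite aE dotZl orth// mulr0.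
(* [X] vanishes only on equal or antipodal pairs, and an antipodal pair would make [a] and [b]
   antipodal. *)
have Xinj p q : Ctr z p -> Ctr z q -> X p q = 0 -> p = q.
  move=> Cp Cq /(X0 _ _ Cp Cq)[//|[p1 q1]].
  apply: (eq_co (x := z) xi01); first by rewrite -/c1 p1 q1.
  rewrite -/c2; apply: contrapT => pq; apply: nanti.
  have [a2 b2] : c2 a = eps /\ c2 b = - eps.
    have := aM _ Cp; have := aM _ Cq; have := bm _ Cp; have := bm _ Cq.
    have := c2_bound _ Ca; have := c2_bound _ Cb; rewrite -/c2.
    move=> /andP[? ?] /andP[? ?] ? ? ? ?.
    case: (c1_eq0 _ Cp p1) => p2; case: (c1_eq0 _ Cq q1) => q2;
      by [case: pq; rewrite p2 q2|split; lra].
  split.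
  - by apply: c2_eps => //; rewrite a2.
  - by apply: c2_eps => //; rewrite b2 sqrrN.
  - by rewrite a2 b2; lra.
have lea p : Ctr z p -> dot (p - z) (- tang a) <= 0.
  move=> Cp; rewrite dotNr dtang XC mulrN opprK pmulr_rle0//.
  by apply: Xle => //; exact: aM.
have leb p : Ctr z p -> dot (p - z) (tang b) <= 0.
  by move=> Cp; rewrite dtang pmulr_rle0//; apply: Xle => //; exact: bm.
have oab : outward_directions E eps z (- tang a) /\
    outward_directions E eps z (tang b).
  suff [v Hv] : exists v, forall p, Ctr z p -> dot (p - z) v < 0.
    split; apply: (outward_limit cE eps0 bz _ Hv) => //.
      by rewrite enormN; apply/enorm_eqE => //; rewrite tangN// expr1n.
    by apply/enorm_eqE => //; rewrite tangN// expr1n.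
  have [ab|ab] := pselect (a = b).
    exists (z - a) => p Cp.
    have -> : p = a.
      apply: Xinj => //; apply/eqP; rewrite eq_le; apply/andP; split.
        by apply: Xle => //; rewrite ab; exact: bm.
      rewrite XC oppr_ge0; apply: Xle => //; exact: aM.
    rewrite -[z - a]opprB dotNr oppr_lt0 -sqr_enorm.
    by have /(contributorsP cE eps0 _ bz)[_ ->] := Ca; rewrite exprn_gt0.
  (* No contributor is ahead of either tangent, and one orthogonal to both would equal both [a] and
     [b]. *)
  exists (- tang a + tang b) => p Cp; rewrite dotDr.
  have := lea _ Cp; have := leb _ Cp; rewrite le_eqVlt => /orP[/eqP pb|]; last by lra.
  rewrite le_eqVlt => /orP[/eqP pa|]; last by lra.
  move: pa pb; rewrite dotNr !dtang => pa pb; exfalso; apply: ab.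
  have XV q : eps^-1 * X p q = 0 -> X p q = 0.
    by move=> /eqP; rewrite mulf_eq0 gt_eqF//= => /eqP.
  have -> : a = p.
    by symmetry; apply: Xinj => //; apply: XV; apply/eqP; rewrite -oppr_eq0 pa.
  exact/Xinj/XV.
(* The direction is plus or minus the tangent at [y]; as no contributor is ahead of it, [y] is the
   lowest, respectively the highest, one. *)
have classify xi y : outward_directions E eps z xi -> Ctr z y ->
    dot (y - z) xi = 0 -> (xi = - tang a /\ y = a) \/ (xi = tang b /\ y = b).
  move=> oxi Cy y0; case: (tangU _ _ oxi Cy y0) => xiE; [right|left].
    have yb : y = b.
      apply: Xinj => //; apply/eqP; rewrite eq_le; apply/andP; split.
        by apply: Xle => //; exact: bm.
      have := outward_le cE eps0 bz oxi Cb.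
      by rewrite xiE dtang pmulr_rle0// XC oppr_le0.
    by rewrite xiE yb.
  have ya : y = a.
    apply: Xinj => //; apply/eqP; rewrite eq_le; apply/andP; split.
      have := outward_le cE eps0 bz oxi Ca.
      by rewrite xiE dotNr dtang -mulrN pmulr_rle0// -XC.
    rewrite XC oppr_ge0; apply: Xle => //; exact: aM.
  by rewrite xiE ya.
have dirs : extremal_directions E eps z = [set - tang a; tang b].
  apply/seteqP; split => xi.
    move=> [oxi [y [Cy y0]]].
    by case: (classify _ _ oxi Cy y0) => -[-> _]; [left|right].
  case=> ->; split; [by case: oab| |by case: oab|].
    by exists a; split => //; rewrite dotNr dtang Xxx mulr0 oppr0.
  by exists b; split => //; rewrite dtang Xxx mulr0.
split => //.
  apply/seteqP; split => y.
    move=> [Cy [xi [oxi y0]]].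
    by case: (classify _ _ oxi Cy y0) => -[_ ->]; [left|right].
  case=> ->; split => //.
    by exists (- tang a); split; [case: oab|rewrite dotNr dtang Xxx mulr0 oppr0].
  by exists (tang b); split; [case: oab|rewrite dtang Xxx mulr0].
have [ab|ab] := pselect (a = b).
  apply: (@SingleContributor _ _ _ (- tang a)) => //.
  - apply/seteqP; split => [p Cp|p ->//].
    apply: Xinj => //; apply/eqP; rewrite eq_le; apply/andP; split.
      by apply: Xle => //; rewrite ab; exact: bm.
    rewrite XC oppr_ge0; apply: Xle => //; exact: aM.
  - by rewrite dotNl dotNr opprK tangN.
  - by rewrite dotNr dtang Xxx mulr0 oppr0.
  - by rewrite dirs opprK ab.
have Xab : X a b <> 0 by move/(Xinj _ _ Ca Cb).
have kab (k : R) : tang b = k *: tang a -> False.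
  move=> h; apply: Xab; have : dot (a - z) (tang b) = 0.
    by rewrite h dotZr dtang Xxx !mulr0.
  by rewrite dtang => /eqP; rewrite mulf_eq0 gt_eqF//= => /eqP.
apply: (@ObliqueContributors _ _ _ (- tang a) (tang b)) => //.
- by move=> h; apply: (kab (-1)); rewrite -h scaleN1r.
- by move/oppr_inj => h; apply: (kab 1); rewrite -h scale1r.
Qed.

End Extremal.

(** * The cusp between two antipodal contributors *)

(** On the right quarter of a circle a chord is at least as vertical as horizontal, while [(a, b)]
    is strictly more vertical than horizontal, so going up increases the scalar product. *)
Lemma circle_mono (R : realFieldType) (s t s' t' a b : R) :
  0 < s -> 0 < s' -> s ^+ 2 + t ^+ 2 = s' ^+ 2 + t' ^+ 2 ->
  t ^+ 2 <= s ^+ 2 -> t' ^+ 2 <= s' ^+ 2 -> t < t' -> a ^+ 2 < b ^+ 2 -> 0 < b ->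
  s * a + t * b < s' * a + t' * b.
Proof.
move=> s0 s'0 st ts ts' tt' ab b0.
have sqle (u v : R) : 0 < v -> u ^+ 2 <= v ^+ 2 -> - v <= u <= v.
  move=> v0 uv; rewrite -ler_norml -ler_sqr ?nnegrE ?(ltW v0)//.
  by rewrite real_normK ?num_real.
have /andP[h1 h2] := sqle _ _ s0 ts; have /andP[h3 h4] := sqle _ _ s'0 ts'.
have a1 : - b < a by rewrite ltNge; apply/negP => ?; nra.
have a2 : a < b by rewrite ltNge; apply/negP => ?; nra.
have ss : 0 < s + s' by rewrite addr_gt0.
(* The chord bounds come from (s' - s)(s' + s) = (t - t')(t + t') and |t + t'| <= s + s'. *)
have P1 : s' - s <= t' - t.
  rewrite -(ler_pM2r ss); have : 0 <= (t' - t) * (s + s' + t + t').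
    by rewrite mulr_ge0//; lra.
  nra.
have P2 : - (t' - t) <= s' - s.
  rewrite -(ler_pM2r ss); have : 0 <= (t' - t) * (s + s' - t - t').
    by rewrite mulr_ge0//; lra.
  nra.
have [a0|a0] := leP 0 a.
  have : 0 <= (s' - s + (t' - t)) * a by rewrite mulr_ge0//; lra.
  have : 0 < (t' - t) * (b - a) by rewrite mulr_gt0// subr_gt0.
  nra.
have : 0 <= (t' - t - (s' - s)) * - a by rewrite mulr_ge0//; lra.
have : 0 < (t' - t) * (b + a) by rewrite mulr_gt0//; lra.
nra.
Qed.

(** The open and the closed disk of radius [r] have the same trace on [D] minus [N], which is thus
    relatively open and closed. *)
Lemma circle_disconnect (R : realType) (D N : set 'rV[R]_2) x (r : R) :
  (forall v, D v -> enorm (v - x) = r -> N v) ->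
  (exists u, [/\ D u, ~ N u & enorm (u - x) < r]) ->
  (exists u, [/\ D u, ~ N u & r < enorm (u - x)]) ->
  ~ connected (D `\` N).
Proof.
move=> H [u [Du Nu ur]] [w [Dw Nw wr]] C.
have : (D `\` N) `&` eball x r = D `\` N.
  apply: C.
  - by exists u; split.
  - by exists (eball x r) => //; exact: open_eball.
  - exists [set z | enorm (z - x) <= r].
      by apply: compact_closed_rV; exact: compact_closed_eball.
    apply/seteqP; split=> z [[Dz Nz] /= zr]; split => //; first exact: ltW.
    rewrite /eball /= lt_neqAle zr andbT; apply/eqP => /(H _ Dz).
    exact: Nz.
move/seteqP => [_ /(_ w)[//|_]].
by rewrite /eball /= ltNge (ltW wr).
Qed.

Section Cusp.
Variables (R : realType) (E : set 'rV[R]_2) (eps : R).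
Hypotheses (cE : compact E) (eps0 : 0 < eps).
Implicit Types u v w y z p q : 'rV[R]_2.

Local Notation N := (nbhd E eps).
Local Notation dN := (boundary (nbhd E eps)).
Local Notation Ctr := (contributors E eps).
Local Notation outside := (outside E eps).

Variables x xi : 'rV[R]_2.
Hypotheses (bx : dN x) (xi1 : dot xi xi = 1).
Hypotheses (Etop : E (x + eps *: perp xi)) (Ebot : E (x - eps *: perp xi)).
Hypothesis left_contributors : forall p, Ctr x p -> dot (p - x) xi <= 0.

Local Notation s := (co1 x xi).
Local Notation t := (co2 x xi).
Local Notation rad z := (enorm (z - x)).

(** The closed counterpart of [outside], shared by outside points and boundary points so that the
    cusp estimates serve both. *)
Definition far z := forall p, E p -> eps <= enorm (p - z).

Lemma outside_far z : outside z -> far z.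
Proof. by move=> oz p /oz /ltW. Qed.

Lemma boundary_far z : dN z -> far z.
Proof. by move=> bz p; exact: boundary_dist. Qed.

Lemma rad2 z : rad z ^+ 2 = s z ^+ 2 + t z ^+ 2.
Proof. by rewrite sqr_enorm (@dist_co_x _ x xi xi1). Qed.

Lemma dist2 p z : enorm (p - z) ^+ 2 = (s p - s z) ^+ 2 + (t p - t z) ^+ 2.
Proof. by rewrite sqr_enorm (dist_co x xi1). Qed.

Lemma s_top : s (x + eps *: perp xi) = 0.
Proof. by rewrite /co1 [_ - x]addrC addKr dotZl dot_perpl mulr0. Qed.
Lemma t_top : t (x + eps *: perp xi) = eps.
Proof. by rewrite /co2 [_ - x]addrC addKr dotZl dot_perp_perp xi1 mulr1. Qed.
Lemma s_bot : s (x - eps *: perp xi) = 0.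
Proof. by rewrite /co1 [_ - x]addrC addKr dotNl dotZl dot_perpl mulr0 oppr0. Qed.
Lemma t_bot : t (x - eps *: perp xi) = - eps.
Proof. by rewrite /co2 [_ - x]addrC addKr dotNl dotZl dot_perp_perp xi1 mulr1. Qed.

(** This is the region between the two tangent disks: expand the distances of [z] to both
    centres. *)
Lemma cusp z : far z -> 2 * eps * `|t z| <= rad z ^+ 2.
Proof.
move=> fz; have e0 := eps0.
have sq p : E p -> eps ^+ 2 <= (s p - s z) ^+ 2 + (t p - t z) ^+ 2.
  by move=> /fz; rewrite -dist2 ler_sqr ?nnegrE ?enorm_ge0 ?(ltW eps0).
have := sq _ Etop; have := sq _ Ebot.
rewrite s_top t_top s_bot t_bot rad2 => h1 h2.
have [t0|t0] := leP 0 (t z); [rewrite (ger0_norm t0)|rewrite (ltr0_norm t0)]; nra.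
Qed.

Lemma cusp_steep z : far z -> rad z <= eps / 4 -> 64 * t z ^+ 2 <= rad z ^+ 2.
Proof.
move=> fz rz; have e0 := eps0; have := cusp fz; have := enorm_ge0 (z - x).
rewrite -[t z ^+ 2]real_normK ?num_real//.
move: rz (normr_ge0 (t z)); set r := rad z; set T := `|_| => rz T0 r0 H.
have h1 : 2 * eps * T <= eps / 4 * r by nra.
have h2 : 8 * T <= r by rewrite -(ler_pM2l e0); nra.
nra.
Qed.

Lemma rad_gt0 z : z <> x -> 0 < rad z.
Proof. by move=> zx; rewrite enorm_gt0 subr_eq0; exact/eqP. Qed.

Lemma rad_s_gt0 z : 0 < s z -> 0 < rad z.
Proof.
by move=> s0; apply: rad_gt0 => zx; move: s0; rewrite zx co1_x ltxx.
Qed.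

(* The points of E that cover a point z near x lie close to the normal line of
   the cusp at x; their tangential coordinate is at most c once z satisfies the
   bound of lemma cusp. *)
Definition steep (c r0 : R) := forall z p, 0 < s z -> rad z < r0 ->
  16 * t z ^+ 2 <= rad z ^+ 2 -> E p -> enorm (p - z) <= eps ->
  s p ^+ 2 < t p ^+ 2 /\ (2 * eps * `|t z| <= rad z ^+ 2 -> s p ^+ 2 <= c ^+ 2).

(** Points of [E] with tangential coordinate at least [c] keep a gap from [x], so they cover nothing
    nearby. Any other covering [p] is no farther from [z] than from [x], hence has positive scalar
    product with [z - x], and the flatness of [z] makes its normal coordinate dominate. *)
Lemma steep_exists (c : R) : 0 < c -> c <= eps / 4 ->
  exists r0 : R, [/\ 0 < r0, r0 <= c / 2 & steep c r0].
Proof.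
move=> c0 ce; have e0 := eps0.
have cK := compact_setI_ge (c := c) cE (@continuous_co1 _ x xi).
have [|h h0 hK] := @compact_dist_gap _ _ x eps cK.
  move=> p [Ep /= sp]; apply: (boundary_dist_gt cE eps0 bx Ep) => Cp.
  have := left_contributors Cp.
  by rewrite leNgt => /negP; apply; exact: lt_le_trans sp.
pose r0 := Num.min h (c / 2); exists r0; split.
- by rewrite lt_min h0 divr_gt0.
- by rewrite ge_min lexx orbT.
move=> z p sz0; rewrite lt_min => /andP[zh zc] tz Ep pz.
have rz0 := rad_s_gt0 sz0.
have prad : rad p < eps + h.
  have := enorm_triangle z p x; lra.
have pc : s p < c.
  rewrite ltNge; apply/negP => pc; have := hK _ (conj Ep pc); lra.
have p_eps : eps ^+ 2 <= s p ^+ 2 + t p ^+ 2.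
  rewrite -rad2 ler_sqr ?nnegrE ?enorm_ge0 ?(ltW eps0)//.
  exact: boundary_dist Ep.
have pz2 : (s p - s z) ^+ 2 + (t p - t z) ^+ 2 <= eps ^+ 2.
  by rewrite -dist2 ler_sqr ?nnegrE ?enorm_ge0 ?(ltW eps0).
have rz := rad2 z.
have rz20 : 0 < rad z ^+ 2 by rewrite exprn_gt0.
have inner : 0 < s z * s p + t z * t p by nra.
have [sp0|sp0] := leP (s p) 0; last first.
  split; last by move=> _; rewrite ler_sqr ?nnegrE ltW.
  have : s p ^+ 2 < (eps / 4) ^+ 2.
    by rewrite ltr_sqr ?nnegrE ?(ltW sp0) ?divr_ge0 ?(ltW eps0)//; lra.
  rewrite expr_div_n; nra.
have sq : s z ^+ 2 * s p ^+ 2 < t z ^+ 2 * t p ^+ 2.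
  rewrite -!exprMn -[(s z * s p) ^+ 2]sqrrN ltr_sqr ?nnegrE; [|nra|nra].
  lra.
have sz20 : 0 < s z ^+ 2 by rewrite exprn_gt0.
split.
  rewrite -(ltr_pM2l sz20); apply: lt_le_trans sq _.
  by rewrite ler_wpM2r ?sqr_ge0//; lra.
move=> tr.
have pr : t p ^+ 2 <= (2 * eps) ^+ 2.
  apply: (@le_trans _ _ (rad p ^+ 2)); first by rewrite rad2 lerDr sqr_ge0.
  rewrite ler_sqr ?nnegrE ?enorm_ge0 ?mulr_ge0 ?(ltW eps0)//.
  have := enorm_triangle z p x; lra.
(* Here [2 * eps] bounds the normal coordinate of [p], so the cusp inequality for [z] applies after
   squaring. *)
have H1 : s z ^+ 2 * s p ^+ 2 < rad z ^+ 2 * rad z ^+ 2.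
  apply: lt_le_trans sq _.
  apply: (@le_trans _ _ (t z ^+ 2 * (2 * eps) ^+ 2)).
    by rewrite ler_wpM2l ?sqr_ge0.
  rewrite -[t z ^+ 2]real_normK ?num_real// -exprMn -[leRHS]expr2.
  rewrite ler_sqr ?nnegrE ?sqr_ge0//; last by rewrite !mulr_ge0// ltW.
  by rewrite mulrC.
have H2 : rad z ^+ 2 <= 2 * s z ^+ 2 by lra.
have H3 : s p ^+ 2 < 2 * rad z ^+ 2.
  rewrite -(ltr_pM2l sz20); apply: lt_le_trans H1 _.
  have := ler_wpM2l (ltW rz20) H2; lra.
have : rad z ^+ 2 <= (c / 2) ^+ 2.
  by rewrite ler_sqr ?nnegrE ?(ltW zc) ?(ltW rz0)// ltW// divr_gt0.
rewrite expr_div_n; lra.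
Qed.

(** The sign [sg] selects the upper or lower side. On a circle about [x], the distance to [p]
    decreases as the scalar product with [p - x] grows, and [circle_mono] controls the latter. *)
Lemma circle_closer (sg : R) z v p : sg ^+ 2 = 1 -> 0 < s z -> 0 < s v ->
  rad z = rad v -> 2 * t z ^+ 2 <= rad z ^+ 2 -> 2 * t v ^+ 2 <= rad v ^+ 2 ->
  sg * t z < sg * t v -> s p ^+ 2 < t p ^+ 2 -> 0 < sg * t p ->
  enorm (p - v) < enorm (p - z).
Proof.
move=> sg2 sz sv zv tz tv tzv stp tp0.
have rz := rad2 z; have rv := rad2 v.
have K (a : R) : (sg * a) ^+ 2 = a ^+ 2 by rewrite exprMn sg2 mul1r.
have := @circle_mono _ (s z) (sg * t z) (s v) (sg * t v) (s p) (sg * t p).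
rewrite !K => /(_ sz sv).
have e1 : s z ^+ 2 + t z ^+ 2 = s v ^+ 2 + t v ^+ 2 by rewrite -rz -rv zv.
have e2 : t z ^+ 2 <= s z ^+ 2 by lra.
have e3 : t v ^+ 2 <= s v ^+ 2 by lra.
move=> /(_ e1 e2 e3 tzv stp tp0).
have L a b : sg * a * (sg * b) = a * b.
  by rewrite mulrACA -expr2 sg2 mul1r.
rewrite !L => H.
rewrite -ltr_sqr ?nnegrE ?enorm_ge0// !dist2; nra.
Qed.

(** Only signs of normal coordinates are recorded; near [x] the bound [steep] turns them into
    closeness to the two centres. *)
Definition pinch z := [/\ dN z, 0 < s z &
  exists p q, [/\ Ctr z p, Ctr z q, 0 < t p & t q < 0]].

(** A point of the arc above [z] is closer to the upper contributor than [z] is, a point below it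
    closer to the lower one. *)
Lemma pinch_circle c r0 z v : steep c r0 -> r0 <= eps / 4 -> pinch z ->
  rad z < r0 -> 0 < s v -> rad v = rad z -> N v.
Proof.
move=> st r0e [bz sz [p [q [Cp Cq tp tq]]]] zr sv vz.
apply: contrapT => /(not_nbhdP cE eps0) ov.
have fz := boundary_far bz; have fv := outside_far ov.
have e0 := eps0.
have tz : 64 * t z ^+ 2 <= rad z ^+ 2 by apply: cusp_steep => //; lra.
have tv : 64 * t v ^+ 2 <= rad v ^+ 2 by apply: cusp_steep => //; lra.
have t2z := sqr_ge0 (t z); have t2v := sqr_ge0 (t v).
have [Ep pz] := (contributorsP cE eps0 p bz).1 Cp.
have [Eq qz] := (contributorsP cE eps0 q bz).1 Cq.
have [|||||stp _] := st z p; rewrite ?pz//; first by lra.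
have [|||||stq _] := st z q; rewrite ?qz//; first by lra.
have [tzv|tzv|tzv] := ltgtP (t z) (t v).
- have := ov _ Ep; rewrite -pz ltNge => /negP; apply; apply: ltW.
  by apply: (@circle_closer 1) => //; rewrite ?expr1n ?mul1r//; lra.
- have := ov _ Eq; rewrite -qz ltNge => /negP; apply; apply: ltW.
  by apply: (@circle_closer (-1)) => //; rewrite ?sqrrN ?expr1n ?mulN1r//; lra.
- have svz : s z = s v.
    have := rad2 z; have := rad2 v; rewrite vz tzv => -> /eqP.
    by rewrite (inj_eq (addIr _)) eqf_sqr => /orP[] /eqP; lra.
  have zv : z = v by exact: (@eq_co _ x xi xi1).
  by have := ov _ Ep; rewrite -zv pz ltxx.
Qed.

(** Seen from [x], [p] and [q] are nearly opposite; moving the apex to [z] costs at most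
    [5 * r0 * eps]. The constants make the total error at most [eta * eps ^+ 2]. *)
Lemma pinch_dot (c r0 eta : R) z p q : steep c r0 -> 0 < c -> c <= eps / 4 ->
  0 < eta -> 8 * c <= eta * eps -> r0 <= c / 2 ->
  dN z -> 0 < s z -> rad z < r0 -> Ctr z p -> Ctr z q -> 0 < t p -> t q < 0 ->
  dot (p - z) (q - z) <= eps ^+ 2 * (eta - 1).
Proof.
move=> st c0 ce eta0 etae r0c bz sz zr Cp Cq tp tq.
have e0 := eps0.
have fz := boundary_far bz.
have tz : 64 * t z ^+ 2 <= rad z ^+ 2 by apply: cusp_steep => //; lra.
have t2z := sqr_ge0 (t z).
have K y : Ctr z y -> [/\ s y ^+ 2 <= c ^+ 2, eps ^+ 2 <= s y ^+ 2 + t y ^+ 2 &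
    rad y <= 2 * eps].
  move=> /(contributorsP cE eps0 y bz)[Ey yz].
  have [||||//|_ /(_ (cusp fz)) sy] := st z y; rewrite ?yz//; first by lra.
  split => //.
    by rewrite -rad2 ler_sqr ?nnegrE ?enorm_ge0 ?(ltW eps0)//; exact: boundary_dist Ey.
  have := enorm_triangle z y x; lra.
have [sp pe pr] := K _ Cp; have [sq qe qr] := K _ Cq.
have -> : p - z = (p - x) - (z - x) by rewrite opprB addrA subrK.
have -> : q - z = (q - x) - (z - x) by rewrite opprB addrA subrK.
have -> : dot (p - x - (z - x)) (q - x - (z - x)) =
  dot (p - x) (q - x) - dot (z - x) (p - x) - dot (z - x) (q - x) + dot (z - x) (z - x).
  by rewrite !dotE !mxE; ring.
have b1 : - dot (z - x) (p - x) <= r0 * (2 * eps).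
  have := cauchy_schwarz (z - x) (p - x); rewrite ler_norml => /andP[h _].
  have : rad z * rad p <= r0 * (2 * eps) by rewrite ler_pM ?enorm_ge0 ?(ltW zr).
  lra.
have b2 : - dot (z - x) (q - x) <= r0 * (2 * eps).
  have := cauchy_schwarz (z - x) (q - x); rewrite ler_norml => /andP[h _].
  have : rad z * rad q <= r0 * (2 * eps) by rewrite ler_pM ?enorm_ge0 ?(ltW zr).
  lra.
have b3 : dot (z - x) (z - x) <= r0 * eps.
  rewrite -sqr_enorm expr2 ler_pM ?enorm_ge0 ?(ltW zr)//; lra.
have b4 : dot (p - x) (q - x) <= 2 * c ^+ 2 - eps ^+ 2.
  rewrite (parseval xi1) -/(s p) -/(s q) -/(t p) -/(t q).
  have h1 : s p * s q <= c ^+ 2.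
    by have := sqr_ge0 (s p - s q); nra.
  (* The normal coordinates have opposite signs and squares at least [eps ^+ 2 - c ^+ 2]. *)
  have h2 : eps ^+ 2 - c ^+ 2 <= - (t p * t q).
    rewrite -(mulrN (t p)); have k1 : eps ^+ 2 - c ^+ 2 <= t p ^+ 2 by lra.
    have k2 : eps ^+ 2 - c ^+ 2 <= (- t q) ^+ 2 by rewrite sqrrN; lra.
    have k0 : 0 <= eps ^+ 2 - c ^+ 2.
      by rewrite subr_ge0 ler_sqr ?nnegrE ?(ltW c0) ?(ltW eps0)//; lra.
    have tq' : 0 < - t q by lra.
    move: k2 tq'; set b := - t q => k2 tq'.
    have tb0 : 0 <= t p * b by rewrite mulr_ge0// ltW.
    rewrite -[_ <= _]ler_sqr ?nnegrE ?k0 ?tb0// exprMn expr2.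
    exact: ler_pM.
  lra.
have : c ^+ 2 <= c * eps / 4 by rewrite expr2 -mulrA ler_wpM2l ?(ltW c0).
have : eps * (8 * c) <= eps * (eta * eps) by rewrite ler_wpM2l ?(ltW eps0).
have : r0 * eps <= c / 2 * eps by rewrite ler_wpM2r ?(ltW eps0).
nra.
Qed.

(* On the same side of the cusp, p and q would subtend a small angle at z. *)
Lemma opposite_contributors c r0 z p q : steep c r0 -> r0 <= eps / 16 ->
  dN z -> 0 < s z -> rad z < r0 -> Ctr z p -> Ctr z q ->
  dot (p - z) (q - z) < - (eps ^+ 2 / 2) -> pinch z.
Proof.
move=> st r0e bz sz zr Cp Cq pq; have e0 := eps0.
have fz := boundary_far bz.
have tz : 64 * t z ^+ 2 <= rad z ^+ 2 by apply: cusp_steep => //; lra.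
have t2z := sqr_ge0 (t z).
have K y : Ctr z y -> s y ^+ 2 < t y ^+ 2 /\ rad y <= 2 * eps.
  move=> /(contributorsP cE eps0 y bz)[Ey yz].
  have [||||//|sy _] := st z y; rewrite ?yz//; first by lra.
  split => //; have := enorm_triangle z y x; lra.
have [sp pr] := K _ Cp; have [sq qr] := K _ Cq.
have tt : t p * t q < 0.
  rewrite ltNge; apply/negP => tt.
  have inner : 0 <= dot (p - x) (q - x).
    rewrite (parseval xi1) -/(s p) -/(s q) -/(t p) -/(t q).
    (* Both points are steeper than the diagonal, so on a common side the normal part dominates the
       scalar product. *)
    have : `|s p * s q| <= t p * t q.
      rewrite -ler_sqr ?nnegrE// real_normK ?num_real// !exprMn.
      by rewrite ler_pM ?sqr_ge0// ltW.
    by rewrite ler_norml => /andP[]; lra.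
  move: pq; rewrite ltNge => /negP; apply.
  have -> : p - z = (p - x) - (z - x) by rewrite opprB addrA subrK.
  have -> : q - z = (q - x) - (z - x) by rewrite opprB addrA subrK.
  have -> : dot (p - x - (z - x)) (q - x - (z - x)) =
    dot (p - x) (q - x) - dot (z - x) (p - x) - dot (z - x) (q - x) + dot (z - x) (z - x).
    by rewrite !dotE !mxE; ring.
  have b1 : dot (z - x) (p - x) <= r0 * (2 * eps).
    by apply: le_trans (dot_le _ _) _; rewrite ler_pM ?enorm_ge0 ?(ltW zr).
  have b2 : dot (z - x) (q - x) <= r0 * (2 * eps).
    by apply: le_trans (dot_le _ _) _; rewrite ler_pM ?enorm_ge0 ?(ltW zr).
  have := dot_ge0 (z - x).
  have : r0 * eps <= eps / 16 * eps by rewrite ler_wpM2r ?(ltW eps0).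
  nra.
have tp0 : t p != 0 by apply/eqP => h; move: tt; rewrite h mul0r ltxx.
split => //; have [tp|tp|tp] := ltgtP (t p) 0.
- by exists q, p; split => //; rewrite -(nmulr_rlt0 _ tp).
- by exists p, q; split => //; rewrite -(pmulr_rlt0 _ tp).
- by rewrite tp eqxx in tp0.
Qed.

End Cusp.

(** * Connectedness of an unpinched cusp *)

Section Slices.
Variables (R : realType) (E : set 'rV[R]_2) (eps : R).
Hypotheses (cE : compact E) (eps0 : 0 < eps).
Implicit Types u v w y z p q : 'rV[R]_2.

Local Notation N := (nbhd E eps).
Local Notation dN := (boundary (nbhd E eps)).
Local Notation Ctr := (contributors E eps).
Local Notation outside := (outside E eps).

Variables x xi : 'rV[R]_2.
Hypotheses (bx : dN x) (xi1 : dot xi xi = 1).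
Hypotheses (Etop : E (x + eps *: perp xi)) (Ebot : E (x - eps *: perp xi)).

Local Notation s := (co1 x xi).
Local Notation t := (co2 x xi).
Local Notation rad z := (enorm (z - x)).

Variables c r0 : R.
Hypotheses (st : steep E eps x xi c r0) (r0e : r0 <= eps / 4).

Definition arc_pt (r a : R) : 'rV[R]_2 := pt x xi (Num.sqrt (r ^+ 2 - a ^+ 2)) a.

Lemma rad_arc_pt r a : 0 <= r -> a ^+ 2 <= r ^+ 2 -> rad (arc_pt r a) = r.
Proof.
move=> r_ge0 ar; apply/enorm_eqE => //; rewrite (@dist_co_x _ x xi xi1).
by rewrite co1_pt// co2_pt// sqr_sqrtr ?subr_ge0// subrK.
Qed.

Lemma arc_pt_co z : 0 < s z -> z = arc_pt (rad z) (t z).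
Proof.
move=> sz; apply: (@eq_co _ x xi xi1); rewrite /arc_pt ?co1_pt// ?co2_pt//.
by rewrite (rad2 x xi1) addrK sqrtr_sqr gtr0_norm.
Qed.

Lemma continuous_arc_pt r : continuous (arc_pt r).
Proof.
have cs : continuous (fun a : R => Num.sqrt (r ^+ 2 - a ^+ 2)).
  move=> a; apply: continuous_comp; last exact: sqrt_continuous.
  by apply: cvgB; [exact: cvg_cst|exact: exprn_continuous].
by apply: continuous_pt => // a; exact: cvg_id.
Qed.

(** A point of [E] covering [v] from above would also cover [w], one covering it from below would
    cover [u]. *)
Lemma outside_between u v w : outside u -> outside w -> 0 < s u -> 0 < s v ->
  0 < s w -> rad u = rad v -> rad w = rad v -> rad v < r0 ->
  t u <= t v <= t w -> outside v.
Proof.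
move=> ou ow su sv sw uv wv vr /andP[tuv tvw] p Ep.
rewrite ltNge; apply/negP => pv.
have fu := outside_far ou; have fw := outside_far ow.
have e0 := eps0; have h0 := r0e.
have tu : 64 * t u ^+ 2 <= rad u ^+ 2.
  by apply: (cusp_steep eps0 xi1 Etop Ebot) => //; rewrite uv; lra.
have tw : 64 * t w ^+ 2 <= rad w ^+ 2.
  by apply: (cusp_steep eps0 xi1 Etop Ebot) => //; rewrite wv; lra.
have tv : 64 * t v ^+ 2 <= rad v ^+ 2.
  have [t0|t0] := leP 0 (t v).
    have : t v ^+ 2 <= t w ^+ 2 by nra.
    by rewrite wv in tw; lra.
  have : t v ^+ 2 <= t u ^+ 2 by nra.
  by rewrite uv in tu; lra.
have t2u := sqr_ge0 (t u); have t2v := sqr_ge0 (t v); have t2w := sqr_ge0 (t w).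
have [|||sp _] := st _ _ _ Ep pv; rewrite //; first by lra.
have [tp|tp|tp] := ltgtP (t p) 0.
- have := tuv; rewrite le_eqVlt => /orP[/eqP tE|lt_uv].
    have uvE : u = v by rewrite (arc_pt_co su) (arc_pt_co sv) uv tE.
    by have := ou _ Ep; rewrite uvE ltNge pv.
  have := ou _ Ep; rewrite ltNge => /negP; apply; apply: le_trans pv; apply: ltW.
  apply: (circle_closer xi1 (sg := -1) (z := v) (v := u)).
  - by rewrite sqrrN expr1n.
  - exact: sv.
  - exact: su.
  - by rewrite uv.
  - lra.
  - lra.
  - by rewrite !mulN1r ltrN2.
  - exact: sp.
  - by rewrite mulN1r oppr_gt0.
- have := tvw; rewrite le_eqVlt => /orP[/eqP tE|lt_vw].
    have vwE : w = v by rewrite (arc_pt_co sw) (arc_pt_co sv) wv -tE.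
    by have := ow _ Ep; rewrite vwE ltNge pv.
  have := ow _ Ep; rewrite ltNge => /negP; apply; apply: le_trans pv; apply: ltW.
  apply: (circle_closer xi1 (sg := 1) (z := v) (v := w)).
  - by rewrite expr1n.
  - exact: sv.
  - exact: sw.
  - by rewrite wv.
  - lra.
  - lra.
  - by rewrite !mul1r.
  - exact: sp.
  - by rewrite mul1r.
- by move: sp; rewrite tp expr0n ltNge sqr_ge0.
Qed.

(** Sliding [z] along its arc away from the side of its contributors leaves that side behind, while
    the other side is kept off by a gap. *)
Lemma side_exit (sg : R) z : sg ^+ 2 = 1 -> dN z -> 0 < s z -> rad z < r0 ->
  (forall p, Ctr z p -> 0 < sg * t p) ->
  exists v, [/\ outside v, 0 < s v & rad v = rad z].
Proof.
move=> sg2 bz sz zr H; have e0 := eps0; have h0 := r0e.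
have fz := boundary_far cE eps0 bz.
have rz0 := rad_s_gt0 sz.
have tz : 64 * t z ^+ 2 <= rad z ^+ 2.
  by apply: (cusp_steep eps0 xi1 Etop Ebot) => //; lra.
have t2z := sqr_ge0 (t z).
have coE y : co1 x (sg *: perp xi) y = sg * t y by rewrite /co1 dotZr.
have cK := compact_setI_le (c := 0) cE (@continuous_co1 _ x (sg *: perp xi)).
have [|h h_gt0 hK] := @compact_dist_gap _ _ z eps cK.
  move=> p [Ep /= tp]; apply: (boundary_dist_gt cE eps0 bz Ep) => /H.
  by rewrite -coE ltNge tp.
(* The bound [h / 2] respects the gap, the bound [rad z / 16] keeps the new point flat enough for
   [steep]. *)
pose k := Num.min (h / 2) (rad z / 16).
have k0 : 0 < k by rewrite lt_min !divr_gt0.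
have kh : k <= h / 2 by rewrite ge_min lexx.
have kr : k <= rad z / 16 by rewrite ge_min lexx orbT.
pose a := t z - sg * k.
have sgk : (sg * k) ^+ 2 = k ^+ 2 by rewrite exprMn sg2 mul1r.
have k2 : k ^+ 2 <= (rad z / 16) ^+ 2.
  by rewrite ler_sqr ?nnegrE ?(ltW k0)// divr_ge0// ltW.
have a2 : 16 * a ^+ 2 <= rad z ^+ 2.
  have : a ^+ 2 <= 2 * t z ^+ 2 + 2 * k ^+ 2.
    rewrite -sgk /a; have := sqr_ge0 (t z + sg * k); lra.
  rewrite expr_div_n in k2; lra.
have a20 := sqr_ge0 a.
pose v := arc_pt (rad z) a.
have tv : t v = a by rewrite co2_pt.
have sv : 0 < s v.
  rewrite co1_pt// sqrtr_gt0 subr_gt0; have : 0 < rad z ^+ 2 by rewrite exprn_gt0.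
  lra.
have rv : rad v = rad z by apply: rad_arc_pt; [exact: ltW|lra].
have vz : enorm (v - z) < h.
  rewrite enorm_ltE ?(ltW h_gt0)// (dist_co x xi1) tv.
  have r2z := rad2 x xi1 z; have r2v := rad2 x xi1 v; rewrite rv tv in r2v.
  have -> : a - t z = - (sg * k) by rewrite /a; ring.
  rewrite sqrrN sgk.
  have ss : 0 < s v + s z by rewrite addr_gt0.
  (* On the flat part of the arc the tangential shift is at most the normal shift [k]. *)
  have sE : (s v - s z) * (s v + s z) = (t z - a) * (t z + a) by rewrite -!subr_sqr; lra.
  have D2 : (s v - s z) ^+ 2 <= k ^+ 2.
    rewrite -(@ler_pM2r _ ((s v + s z) ^+ 2)) ?exprn_gt0//.
    rewrite -exprMn sE exprMn (_ : t z - a = sg * k); last by rewrite /a; ring.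
    rewrite sgk ler_wpM2l ?sqr_ge0//.
    have : (t z + a) ^+ 2 <= 2 * t z ^+ 2 + 2 * a ^+ 2.
      by have := sqr_ge0 (t z - a); lra.
    have : s v ^+ 2 + s z ^+ 2 <= (s v + s z) ^+ 2.
      by have : 0 < s v * s z by [rewrite mulr_gt0]; nra.
    lra.
  have : k ^+ 2 <= (h / 2) ^+ 2.
    by rewrite ler_sqr ?nnegrE ?(ltW k0)// divr_ge0// ltW.
  have : 0 < h ^+ 2 by rewrite exprn_gt0.
  rewrite expr_div_n; lra.
exists v; split => // p Ep; rewrite ltNge; apply/negP => pv.
have tp : 0 < sg * t p.
  rewrite ltNge -coE; apply/negP => tp; have := hK _ (conj Ep tp).
  have := enorm_triangle v p z; lra.
have [|||sp _] := st _ _ _ Ep pv; rewrite ?rv ?tv//.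
have := fz _ Ep; rewrite leNgt => /negP; apply; apply: lt_le_trans pv.
apply: (circle_closer xi1 (sg := sg) (z := v) (v := z)).
- exact: sg2.
- exact: sv.
- exact: sz.
- exact: rv.
- by rewrite rv tv; lra.
- lra.
- by rewrite tv /a mulrBr mulrA -expr2 sg2 mul1r; lra.
- exact: sp.
- exact: tp.
Qed.

Variable d : R.
Hypotheses (d0 : 0 < d) (dr0 : d <= r0).

Let U := half_ball x xi d `\` N.

Lemma half_ball_outsideP u : U u <-> [/\ outside u, 0 < s u & rad u < d].
Proof.
split=> [[[ud su] /(not_nbhdP cE eps0) ou]|[ou su ud]]; first by split.
by split; [split|apply/(not_nbhdP cE eps0)].
Qed.

Lemma slice_connected u w : U u -> U w -> rad u = rad w ->
  exists K, [/\ connected K, K u, K w & K `<=` U].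
Proof.
wlog uw : u w / t u <= t w.
  move=> H Uu Uw ruw; have [|/ltW] := leP (t u) (t w) => h; first exact: H.
  by have [K [? ? ? ?]] := H _ _ h Uw Uu (esym ruw); exists K.
move=> /half_ball_outsideP[ou su ud] /half_ball_outsideP[ow sw wd] ruw.
have e0 := eps0; have h0 := r0e; have h1 := dr0.
exists (arc_pt (rad u) @` `[t u, t w]); split.
- apply: connected_continuous_connected; first exact: segment_connected.
  by apply: continuous_subspaceT; exact: continuous_arc_pt.
- by exists (t u); rewrite /= ?in_itv /= ?lexx// -arc_pt_co.
- by exists (t w); rewrite /= ?in_itv /= ?lexx ?uw// ruw -arc_pt_co.
move=> _ [a /= + <-]; rewrite in_itv /= => /andP[ua aw].
have ru0 := rad_s_gt0 su.
have tu : 64 * t u ^+ 2 <= rad u ^+ 2.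
  by apply: (cusp_steep eps0 xi1 Etop Ebot); [exact: outside_far|lra].
have tw : 64 * t w ^+ 2 <= rad w ^+ 2.
  by apply: (cusp_steep eps0 xi1 Etop Ebot); [exact: outside_far|lra].
have a20 := sqr_ge0 a.
have a2 : 64 * a ^+ 2 <= rad u ^+ 2.
  have [t0|t0] := leP 0 a.
    have : a ^+ 2 <= t w ^+ 2 by nra.
    by rewrite -ruw in tw; lra.
  have : a ^+ 2 <= t u ^+ 2 by nra.
  lra.
have rv : rad (arc_pt (rad u) a) = rad u.
  by apply: rad_arc_pt; [exact: ltW|lra].
have sv : 0 < s (arc_pt (rad u) a).
  rewrite co1_pt// sqrtr_gt0 subr_gt0; have : 0 < rad u ^+ 2 by rewrite exprn_gt0.
  lra.
apply/half_ball_outsideP; split; rewrite ?rv//.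
apply: (@outside_between u _ w) => //; rewrite ?rv ?co2_pt ?ua//.
exact: lt_le_trans dr0.
Qed.

(** Uncovered points can be moved radially a little. The open set [O] allows the use for pieces of
    [U] as well as for [U] itself. *)
Lemma open_radii (O : set 'rV[R]_2) : open O ->
  open [set r | exists2 u, (U `&` O) u & rad u = r].
Proof.
move=> oO; rewrite openE => _ [u [Uu Ou] <-].
have /half_ball_outsideP[ou su ud] := Uu.
have ru0 := rad_s_gt0 su.
have /nbhs_eballP[e [e0 eO]] : nbhs u (O `&` ~` N).
  apply: open_nbhs_nbhs; split.
    by apply: openI => //; apply: closed_openC; exact: closed_nbhd.
  by split => //; apply/(not_nbhdP cE eps0).
have m0 : 0 < Num.min e (Num.min (rad u) (d - rad u)).
  by rewrite !lt_min e0 ru0 subr_gt0.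
apply/nbhs_ballP; exists (Num.min e (Num.min (rad u) (d - rad u))) => //= r.
rewrite /ball /= distrC !lt_min => /and3P[re ru rd].
have r_gt0 : 0 < r by move: ru; rewrite ltr_norml => /andP[]; lra.
have rd' : r < d by move: rd; rewrite ltr_norml => /andP[]; lra.
pose v := x + (r / rad u) *: (u - x).
have vx : v - x = (r / rad u) *: (u - x) by rewrite /v addrC addKr.
have rv : rad v = r.
  by rewrite vx enormZ gtr0_norm ?divr_gt0// divfK// gt_eqF.
have vu : enorm (v - u) < e.
  have -> : v - u = (r / rad u - 1) *: (u - x).
    by rewrite scalerBl scale1r -vx opprB addrA subrK.
  rewrite enormZ -[X in _ * X](gtr0_norm ru0) -normrM mulrBl mul1r divfK//.
  by rewrite gt_eqF.
have [Ov /(not_nbhdP cE eps0) ov] := eO _ vu.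
exists v => //; split => //; apply/half_ball_outsideP; split => //; rewrite ?rv//.
by rewrite /co1 vx dotZl mulr_gt0// divr_gt0.
Qed.

Hypothesis acc : forall h : R, 0 < h ->
  exists u, [/\ outside u, 0 < s u & rad u < h].
Hypothesis nopinch : forall z, pinch E eps x xi z -> rad z < d -> False.

(** The radii of uncovered points form an open and closed subset of []0, d[]; closedness is where
    the absence of pinches enters. *)
Lemma radii_full r : 0 < r -> r < d -> exists2 u, U u & rad u = r.
Proof.
move: r; pose P := [set r | exists2 u, (U `&` setT) u & rad u = r].
have e0 := eps0; have h0 := r0e; have h1 := dr0.
suff PE : P = `]0, d[%classic.
  move=> r r_gt0 rd; have [u [Uu _] ru] : P r; last by exists u.
  by rewrite PE /= in_itv /= r_gt0 rd.
have Psub : P `<=` `]0, d[%classic.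
  move=> _ [u [/half_ball_outsideP[ou su ud] _] <-].
  by rewrite /= in_itv /= ud (rad_s_gt0 su).
have cI : connected (`]0, d[%classic : set R).
  exact/connected_intervalP/interval_is_interval.
apply: cI.
- have [u [ou su ud]] := acc d0.
  by exists (rad u), u => //; split => //; apply/half_ball_outsideP.
- exists P; first exact: open_radii openT.
  by rewrite setIidr.
exists (closure P); first exact: closed_closure.
apply/seteqP; split=> r; first by move=> Pr; split; [exact: Psub|exact: subset_closure].
rewrite /= in_itv /= => -[/andP[r_gt0 rd] cPr].
apply: contrapT => nPr.
have cU : compact (closure U).
  apply: (subclosed_compact _ (@compact_closed_eball _ x d)).
    exact: closed_closure.
  move=> z cz; rewrite /= leNgt; apply/negP => dz.
  have [|u [/half_ball_outsideP[_ _ ud] uz]] := cz _ (@nbhs_eball _ z (rad z - d) _).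
    by rewrite subr_gt0.
  have := enorm_triangle u z x; rewrite /eball /= (enormB u z) in uz; lra.
have cf : continuous (fun z : 'rV[R]_2 => `|rad z - r|).
  move=> z; apply: (@continuous_comp _ _ _ (fun z : 'rV[R]_2 => rad z)
    (fun a => `|a - r|)).
    exact: continuous_dist.
  apply: (@continuous_comp _ _ _ (fun a => a - r) Num.norm).
    by apply: cvgB; [exact: cvg_id|exact: cvg_cst].
  exact: norm_continuous.
(* A point of the closure of [U] with radius closest to [r]; as [r] is a limit of radii, its radius
   is [r]. *)
have [|z cz zm] := compact_min cU _ cf.
  by have [u [ou su ud]] := acc d0; exists u; apply: subset_closure;
    apply/half_ball_outsideP.
have rz : rad z = r.
  apply/subr0_eq/eqP; rewrite -normr_eq0; apply: contrapT => /negP.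
  rewrite -normr_gt0 normr_id => m0.
  have [_ [[u [Uu _] <-]]] := cPr _ (nbhsx_ballx r _ m0).
  rewrite /ball /= distrC ltNge => /negP; apply; apply: zm; exact: subset_closure.
have approx (h : R) : 0 < h -> exists u, U u /\ enorm (u - z) < h.
  by move=> hh; have [u [Uu uz]] := cz _ (nbhs_eball z hh); exists u.
have fz : far E eps z.
  move=> p Ep; rewrite leNgt; apply/negP => pz.
  have [|u [/half_ball_outsideP[ou _ _] uz]] := approx (eps - enorm (p - z)).
    by rewrite subr_gt0.
  have := ou _ Ep; have := enorm_triangle z p u; rewrite (enormB z u); lra.
have sz0 : 0 <= s z.
  rewrite leNgt; apply/negP => sz.
  have [|u [/half_ball_outsideP[_ su _] uz]] := approx (- s z).
    by rewrite oppr_gt0.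
  have := dot_le (u - z) xi.
  have -> : dot (u - z) xi = s u - s z by rewrite /co1 !dotBl; ring.
  have -> : enorm xi = 1 by apply/enorm_eqE => //; rewrite xi1 expr1n.
  lra.
have tz : 64 * t z ^+ 2 <= rad z ^+ 2.
  by apply: (cusp_steep eps0 xi1 Etop Ebot) => //; lra.
have sz : 0 < s z.
  rewrite lt_def sz0 andbT; apply/eqP => sz.
  have := rad2 x xi1 z; rewrite sz expr0n add0r => rE.
  have : 0 < rad z ^+ 2 by rewrite exprn_gt0// rz.
  lra.
have [oz|[p0 [Ep0 pz0]]] := outside_or E eps z.
  by apply: nPr; exists z => //; split => //; apply/half_ball_outsideP; rewrite rz.
have bz : dN z.
  apply/boundaryP => //; split; first by exists p0.
  by move=> h /approx[u [/half_ball_outsideP[ou _ _] uz]]; exists u.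
have t_neq0 p : Ctr z p -> t p != 0.
  move=> /(contributorsP cE eps0 p bz)[Ep pz].
  have t2z := sqr_ge0 (t z).
  have zr0 : rad z < r0 by rewrite rz; lra.
  have tz16 : 16 * t z ^+ 2 <= rad z ^+ 2 by lra.
  have pz' : enorm (p - z) <= eps by rewrite pz.
  have [sp _] := st sz zr0 tz16 Ep pz'.
  by apply/eqP => tp; move: sp; rewrite tp expr0n ltNge sqr_ge0.
(* Without a pinch all contributors of [z] lie on one side, and [side_exit] gives an uncovered point
   of the same radius. *)
suff [sg sg2 H] : exists2 sg : R, sg ^+ 2 = 1 & forall p, Ctr z p -> 0 < sg * t p.
  have [|v [ov sv rv]] := side_exit sg2 bz sz _ H; first by rewrite rz; lra.
  apply: nPr; exists v; rewrite ?rv ?rz//; split => //.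
  by apply/half_ball_outsideP; rewrite rv rz.
have [[p [Cp tp]]|np] := pselect (exists p, Ctr z p /\ 0 < t p).
  exists 1; first by rewrite expr1n.
  move=> q Cq; rewrite mul1r lt_def t_neq0//= leNgt; apply/negP => tq.
  apply: (nopinch (z := z)); last by rewrite rz.
  by split => //; exists p, q.
exists (-1); first by rewrite sqrrN expr1n.
move=> q Cq; rewrite mulN1r oppr_gt0 lt_def eq_sym t_neq0//= leNgt.
by apply/negP => tq; apply: np; exists q.
Qed.

(** A relatively clopen part [B] contains the whole uncovered part of each arc it meets, so [B] and
    its complement have disjoint open sets of radii, which together fill the interval. *)
Lemma half_ball_connected : connected U.
Proof.
move=> B [u0 Bu0] [V oV BO] [W cW BC].
have BU : B `<=` U by rewrite BO => u [].
pose P := [set r | exists2 u, (U `&` V) u & rad u = r].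
pose Q := [set r | exists2 u, (U `&` ~` W) u & rad u = r].
have slice u w : B u -> U w -> rad u = rad w -> B w.
  move=> Bu Uw ruw; have [K [cK Ku Kw KU]] := slice_connected (BU _ Bu) Uw ruw.
  have KB : K `&` B = K.
    apply: cK.
    - by exists u.
    - by exists V => //; rewrite BO setIA (setIidl KU).
    - by exists W => //; rewrite BC setIA (setIidl KU).
  by have [] : (K `&` B) w by rewrite KB.
have PE : P = `]0, d[%classic.
  have cI : connected (`]0, d[%classic : set R).
    exact/connected_intervalP/interval_is_interval.
  have Psub : P `<=` `]0, d[%classic.
    move=> _ [u [/half_ball_outsideP[ou su ud] _] <-].
    by rewrite /= in_itv /= ud (rad_s_gt0 su).
  apply: cI.
  - by exists (rad u0), u0 => //; rewrite -BO.
  - by exists P; [exact: open_radii|rewrite setIidr].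
  exists (~` Q); first by apply: open_closedC; apply: open_radii; exact: closed_openC.
  apply/seteqP; split=> r.
    move=> Pr; split; first exact: Psub.
    case: Pr => u UOu <- [w [Uw Cw] wr]; apply: Cw.
    have : B w by apply: slice Uw (esym wr); rewrite BO.
    by rewrite BC => -[].
  rewrite /= in_itv /= => -[/andP[r_gt0 rd] nQ].
  have [u Uu ur] := radii_full r_gt0 rd.
  exists u => //; rewrite -BO BC; split => //.
  by apply: contrapT => nC; apply: nQ; exists u.
apply/seteqP; split => // w Uw.
have : P (rad w).
  have /half_ball_outsideP[_ sw wd] := Uw.
  by rewrite PE /= in_itv /= wd (rad_s_gt0 sw).
by case=> u UOu uw; apply: (@slice u) => //; rewrite BO.
Qed.

End Slices.

(** * Classification *)

Lemma eq_set2 (T : Type) (a b c d : T) : [set a; b] = [set c; d] ->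
  (a = c /\ b = d) \/ (a = d /\ b = c).
Proof.
move=> H; have Ha : [set c; d] a by rewrite -H; left.
have Hb : [set c; d] b by rewrite -H; right.
have Hc : [set a; b] c by rewrite H; left.
have Hd : [set a; b] d by rewrite H; right.
case: Ha Hb Hc Hd => /= -> [] /= -> Hc Hd; try by [left|right].
- by case: Hd => /= ->; left.
- by case: Hc => /= ->; left.
Qed.

Section Sides.
Variables (R : realType) (E : set 'rV[R]_2) (eps : R).
Hypotheses (cE : compact E) (eps0 : 0 < eps).
Implicit Types u v w y z p q : 'rV[R]_2.

Local Notation N := (nbhd E eps).
Local Notation dN := (boundary (nbhd E eps)).
Local Notation Ctr := (contributors E eps).
Local Notation outside := (outside E eps).

Lemma chain_sequence_opposite x (u : nat -> 'rV[R]_2) (h : R) : 0 < h ->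
  chain_sequence E eps x u -> exists n p q, [/\ dN (u n), enorm (u n - x) < h,
    Ctr (u n) p, Ctr (u n) q & dot (p - u n) (q - u n) < - (eps ^+ 2 / 2)].
Proof.
move=> h0 [su /cvg_enormP ux [y1 [y2 [yE yc]]]].
have half0 : 0 < 1 / 2 :> R by lra.
have H : \forall n \near \oo,
    `|-1 - dot (eps^-1 *: (y1 n - u n)) (eps^-1 *: (y2 n - u n))| < 1 / 2.
  by move/cvgrPdist_lt: yc; apply.
have [n [un yn]] := filter_ex (filterI (ux _ h0) H).
have [bn _] := su n.
exists n, (y1 n), (y2 n).
have Cy y : [set y1 n; y2 n] y -> Ctr (u n) y by rewrite -yE => -[].
split => //; [by apply: Cy; left|by apply: Cy; right|].
move: yn; rewrite /= dotZl dotZr ltr_norml => /andP[+ _].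
set D := dot _ _ => yn.
have e2 : 0 < eps ^+ 2 by rewrite exprn_gt0.
have DE : eps ^+ 2 * (eps^-1 * (eps^-1 * D)) = D by field; rewrite gt_eqF.
rewrite -DE; nra.
Qed.

(** By compactness, contributors of points near [x] lie within [eps / 4] of [a], so any two of them
    subtend a small angle. *)
Lemma single_no_chain x a (u : nat -> 'rV[R]_2) : dN x -> Ctr x = [set a] ->
  chain_sequence E eps x u -> False.
Proof.
move=> bx Ca cu.
have cK := compact_setI_ge (c := eps / 4) cE (@continuous_dist _ a).
have e0 := eps0.
have [|h h0 hK] := @compact_dist_gap _ _ x eps cK.
  move=> p [Ep /= pa]; apply: (boundary_dist_gt cE eps0 bx Ep).
  rewrite Ca => /= pE; move: pa; rewrite pE subrr -(scale0r 0) enormZ normr0 mul0r; lra.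
have [n [p [q [bu un Cp Cq]]]] := chain_sequence_opposite h0 cu.
rewrite ltNge => /negP; apply.
have K y : Ctr (u n) y -> enorm (y - a) < eps / 4 /\ enorm (y - u n) = eps.
  move=> /(contributorsP cE eps0 y bu)[Ey yu]; split => //.
  rewrite ltNge; apply/negP => ya; have := hK _ (conj Ey ya).
  have := enorm_triangle (u n) y x; lra.
have [pa pu] := K _ Cp; have [qa qu] := K _ Cq.
have pq : enorm (p - q) < eps / 2.
  have := enorm_triangle a p q; rewrite (enormB a q); lra.
have : dot (p - q) (p - q) < (eps / 2) ^+ 2 by rewrite -enorm_ltE// divr_ge0// ltW.
have -> : p - q = (p - u n) - (q - u n) by rewrite opprB addrA subrK.
rewrite dot_sqrB -!sqr_enorm pu qu expr_div_n.
have : 0 < eps ^+ 2 by rewrite exprn_gt0.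
lra.
Qed.

(** The two half balls leave only the normal line through [a]. On it, near [x], one side is outside
    and the other is closer than [eps] to [a], so [x] is the only boundary point. *)
Lemma single_smooth x a xi : dN x -> Ctr x = [set a] -> dot xi xi = 1 ->
  dot (a - x) xi = 0 -> smooth_side E eps x xi -> smooth_side E eps x (- xi) ->
  smooth_point E eps x.
Proof.
move=> bx Ca xi1 axi [d1 [d10 H1]] [d2 [d20 H2]]; split => //.
have e0 := eps0.
have [Ea ax] : E a /\ enorm (a - x) = eps.
  by apply/(contributorsP cE eps0 a bx); rewrite Ca.
have aa : dot (a - x) (a - x) = eps ^+ 2 by rewrite -sqr_enorm ax.
have [|t0 t00 exit] := @exit_direction _ E eps cE eps0 x (x - a) bx.
  by move=> y; rewrite Ca => ->; rewrite -[x - a]opprB dotNr oppr_lt0 aa exprn_gt0.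
have m0 : 0 < Num.min (Num.min d1 d2) (Num.min eps (t0 * eps)).
  by rewrite !lt_min d10 d20 eps0 mulr_gt0.
exists (Num.min (Num.min d1 d2) (Num.min eps (t0 * eps))); split => //.
move=> v [bv]; rewrite /eball /= !lt_min => /andP[/andP[v1 v2] /andP[ve vt]].
have [vxi|vxi|vxi] := ltgtP (dot (v - x) xi) 0.
- by apply: H2; split => //; split => //; rewrite dotNr oppr_gt0.
- by apply: H1; split.
suff -> : v = x by split => //; exists a.
pose k := dot (v - x) (a - x) / eps ^+ 2.
have ke : k * eps ^+ 2 = dot (v - x) (a - x) by rewrite divfK// expf_neq0// gt_eqF.
have n1 : dot (perp xi) (perp xi) = 1 by rewrite dot_perp_perp.
have an : dot (a - x) (perp xi) ^+ 2 = eps ^+ 2.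
  by rewrite -aa (parseval xi1 (a - x) (a - x)) axi; ring.
have vk : v - x = k *: (a - x).
  apply/subr0_eq/dot_eq0; rewrite (parseval xi1) dotBl dotZl axi vxi.
  rewrite (dotBl (v - x) _ (perp xi)) (dotZl _ _ (perp xi)).
  have -> : dot (v - x) (perp xi) = k * dot (a - x) (perp xi).
    have a0 : dot (a - x) (perp xi) != 0.
      by rewrite -sqrf_eq0 an expf_neq0// gt_eqF.
    apply: (mulIf a0); rewrite -mulrA -expr2 an ke (parseval xi1 (v - x) (a - x)) vxi.
    ring.
  ring.
have [k0|k0|k0] := ltgtP k 0.
- have Nv : N v by case: bv => cv _; exact: closed_nbhd.
  suff ov : outside v by case: ((not_nbhdP cE eps0 v).2 ov Nv).
  have -> : v = x + (- k) *: (x - a).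
    by rewrite -[x - a]opprB scalerN scaleNr opprK -vk addrC subrK.
  apply: exit; first by rewrite oppr_gt0.
  by move: vt; rewrite vk enormZ ax ltr0_norm// ltr_pM2r.
- have := boundary_dist cE eps0 bv Ea.
  have -> : a - v = (1 - k) *: (a - x).
    by rewrite scalerBl scale1r -vk opprB addrA subrK.
  move: ve; rewrite vk !enormZ ax gtr0_norm// => ve.
  have k1 : k < 1 by rewrite -(ltr_pM2r e0) mul1r.
  have -> : `|1 - k| = 1 - k by rewrite gtr0_norm// subr_gt0.
  by rewrite mulrBl mul1r leNgt ltrBlDr ltrDl mulr_gt0.
- by apply/subr0_eq; rewrite vk k0 scale0r.
Qed.

(** * Sides of a boundary point with antipodal contributors *)

Section Frame.
Variables x xi : 'rV[R]_2.
Hypotheses (bx : dN x) (xi1 : dot xi xi = 1).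
Hypotheses (Etop : E (x + eps *: perp xi)) (Ebot : E (x - eps *: perp xi)).
Hypothesis oxi : outward_directions E eps x xi.

Local Notation s := (co1 x xi).
Local Notation t := (co2 x xi).
Local Notation rad z := (enorm (z - x)).

Let left_contributors p : Ctr x p -> dot (p - x) xi <= 0.
Proof. exact: outward_le. Qed.

Lemma outward_acc (h : R) : 0 < h -> exists u, [/\ outside u, 0 < s u & rad u < h].
Proof.
move=> h0; have /(outwardP cE eps0 xi bx)[nxi H] := oxi.
have m0 : 0 < Num.min h (1 / 2) by rewrite lt_min h0 divr_gt0.
have [u [ou]] := H _ m0; rewrite !lt_min => /andP[uh _] /andP[_ uxi].
exists u; split => //.
have ux := outside_boundary_neq cE eps0 bx ou.
have ru := rad_gt0 ux.
have := cauchy_schwarz ((rad u)^-1 *: (u - x) - xi) xi.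
rewrite nxi mulr1 dotBl dotZl xi1 ler_norml => /andP[h1 _].
have : 0 < (rad u)^-1 * dot (u - x) xi by lra.
by rewrite pmulr_rgt0 // invr_gt0.
Qed.

Definition pinched := forall h : R, 0 < h ->
  exists2 z, pinch E eps x xi z & rad z < h.

(** All small radii are covered because [sharpP] has to shrink the radius further. *)
Lemma not_pinched_connected : ~ pinched ->
  exists2 d0 : R, 0 < d0 & forall d, 0 < d -> d <= d0 ->
    connected (half_ball x xi d `\` N).
Proof.
move=> np; have e0 := eps0.
have [h [h0 hP]] : exists h : R, 0 < h /\
    forall z, pinch E eps x xi z -> rad z < h -> False.
  apply: contrapT => H; apply: np => h h0; apply: contrapT => H'; apply: H.
  by exists h; split => // z pz zh; apply: H'; exists z.
have c0 : 0 < eps / 4 by rewrite divr_gt0.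
have [r0 [r00 r0c st]] := steep_exists cE eps0 bx xi1 left_contributors c0 (lexx _).
have r0e : r0 <= eps / 4 by lra.
exists (Num.min h r0); first by rewrite lt_min h0.
move=> d d0; rewrite le_min => /andP[dh dr].
apply: (half_ball_connected cE eps0 xi1 Etop Ebot st) => //.
  exact: outward_acc.
by move=> z pz zd; apply: (hP z) => //; exact: lt_le_trans dh.
Qed.

(** Two contributors of a pinch are nearly antipodal, and the extremal ones subtend at least their
    angle. *)
Lemma pinched_chain : pinched -> exists u : nat -> 'rV[R]_2,
  (forall n, half_ball x xi 1 (u n)) /\ chain_sequence E eps x u.
Proof.
move=> P; have e0 := eps0.
have /choice[f fP] : forall n : nat, exists zab : 'rV[R]_2 * 'rV[R]_2 * 'rV[R]_2,
    [/\ half_ball x xi n.+1%:R^-1 zab.1.1, singularities E eps zab.1.1,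
      extremal_contributors E eps zab.1.1 = [set zab.1.2; zab.2] &
      `|-1 - dot (eps^-1 *: (zab.1.2 - zab.1.1)) (eps^-1 *: (zab.2 - zab.1.1))|
        <= n.+1%:R^-1].
  move=> n; set eta := _^-1; have eta0 : 0 < eta by rewrite invr_gt0.
  (* The second bound on [c] is the one under which [pinch_dot] yields the error [eta]. *)
  have c0 : 0 < Num.min (eps / 4) (eta * eps / 8).
    by rewrite lt_min !divr_gt0// mulr_gt0.
  have ce : Num.min (eps / 4) (eta * eps / 8) <= eps / 4 by rewrite ge_min lexx.
  have ceta : 8 * Num.min (eps / 4) (eta * eps / 8) <= eta * eps.
    have : Num.min (eps / 4) (eta * eps / 8) <= eta * eps / 8 by rewrite ge_min lexx orbT.
    lra.
  have [r0 [r00 r0c st]] := steep_exists cE eps0 bx xi1 left_contributors c0 ce.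
  have m0 : 0 < Num.min r0 eta by rewrite lt_min r00.
  have [z pz] := P _ m0; rewrite lt_min => /andP[zr zeta].
  have [bz sz [p [q [Cp Cq tp tq]]]] := pz.
  have pq := pinch_dot cE eps0 bx xi1 Etop Ebot st c0 ce eta0 ceta r0c
    bz sz zr Cp Cq tp tq.
  have [a [b [Ca Cb abE abmin _]]] := extremal_structure cE eps0 bz.
  exists (z, a, b); split => //=.
    apply: (two_contributors_singular bz Cp Cq) => pqE.
    by move: tp tq; rewrite pqE => /ltW; rewrite leNgt => /negP.
  have [_ az] := (contributorsP cE eps0 a bz).1 Ca.
  have [_ bz'] := (contributorsP cE eps0 b bz).1 Cb.
  have ab1 := le_trans (abmin _ _ Cp Cq) pq.
  have := cauchy_schwarz (a - z) (b - z); rewrite az bz' ler_norml => /andP[ab2 _].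
  rewrite dotZl dotZr; move: ab1 ab2; set D := dot _ _ => ab1 ab2.
  have e2 : 0 < eps ^+ 2 by rewrite exprn_gt0.
  have DE : eps ^+ 2 * (eps^-1 * (eps^-1 * D)) = D by field; rewrite gt_eqF.
  have D1 : eps^-1 * (eps^-1 * D) <= eta - 1 by rewrite -(ler_pM2l e2) DE.
  have D2 : -1 <= eps^-1 * (eps^-1 * D) by rewrite -(ler_pM2l e2) DE expr2; lra.
  rewrite ler_norml; apply/andP; split; lra.
have nearE (e : R) : 0 < e -> \forall n \near \oo, n.+1%:R^-1 < e.
  by move=> ?; near=> n; near: n; exact: near_infty_natSinv_lt (PosNum _).
exists (fun n => (f n).1.1); split.
  move=> n; have [[fb fs] _ _ _] := fP n; split => //.
  by apply: lt_le_trans fb _; rewrite invf_le1// ler1n.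
split.
- by move=> n; have [] := fP n.
- apply/cvg_enormP => e /nearE; apply: filterS => n; apply: lt_trans.
  by have [[]] := fP n.
- exists (fun n => (f n).1.2), (fun n => (f n).2); split.
    by move=> n; have [] := fP n.
  apply/cvgrPdist_lt => e /nearE; apply: filterS => n; apply: le_lt_trans.
  by have [] := fP n.
Unshelve. all: by end_near. Qed.

Lemma chain_pinched (u : nat -> 'rV[R]_2) (h : R) : 0 < h ->
  (forall n, rad (u n) < h -> 0 < s (u n)) -> chain_sequence E eps x u -> pinched.
Proof.
move=> h0 su cu k k0; have e0 := eps0.
have c0 : 0 < eps / 8 by rewrite divr_gt0.
have ce : eps / 8 <= eps / 4 by lra.
have [r0 [r00 r0c st]] := steep_exists cE eps0 bx xi1 left_contributors c0 ce.
have r0e : r0 <= eps / 16 by lra.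
have m0 : 0 < Num.min (Num.min h k) r0 by rewrite !lt_min h0 k0.
have [n [p [q [bu + Cp Cq pq]]]] := chain_sequence_opposite m0 cu.
rewrite !lt_min => /andP[/andP[uh uk] ur].
exists (u n) => //.
by apply: (opposite_contributors cE eps0 xi1 Etop Ebot st r0e bu _
  ur Cp Cq pq); exact: su.
Qed.

(** The set [D] stands for a half ball or a ball. The covered arc through a pinch nearer to [x] than
    [w] separates [w] from outside points still nearer to [x]. *)
Lemma pinched_disconnected (D : set 'rV[R]_2) (h : R) : pinched -> 0 < h ->
  (forall v, outside v -> D v -> rad v < h -> 0 < s v) ->
  (forall k : R, 0 < k -> exists u, [/\ D u, outside u & rad u < k]) ->
  ~ connected (D `\` N).
Proof.
move=> P h0 Ds Dacc; have e0 := eps0.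
have c0 : 0 < eps / 4 by rewrite divr_gt0.
have [r0 [r00 r0c st]] := steep_exists cE eps0 bx xi1 left_contributors c0 (lexx _).
have r0e : r0 <= eps / 4 by lra.
have [w [Dw ow _]] := Dacc _ h0.
have rw := rad_gt0 (outside_boundary_neq cE eps0 bx ow).
have m0 : 0 < Num.min (Num.min h r0) (rad w) by rewrite !lt_min h0 r00.
have [z pz] := P _ m0; rewrite !lt_min => /andP[/andP[zh zr] zw].
have [bz sz _] := pz.
apply: (@circle_disconnect _ D N x (rad z)).
- move=> v Dv vz; apply: contrapT => /(not_nbhdP cE eps0) ov.
  have /(not_nbhdP cE eps0) := ov; apply.
  apply: (pinch_circle cE eps0 xi1 Etop Ebot st r0e pz zr) => //.
  by apply: Ds => //; rewrite vz.
- have [u [Du ou uz]] := Dacc _ (rad_s_gt0 sz).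
  by exists u; split => //; apply/(not_nbhdP cE eps0).
- by exists w; split => //; apply/(not_nbhdP cE eps0).
Qed.

Lemma sharp_sideP : sharp_side E eps x xi <-> ~ pinched.
Proof.
split=> [[d [d0 cd]] P|/not_pinched_connected[d0 d00 H]]; last first.
  by exists d0; split => //; exact: H.
apply: (@pinched_disconnected (half_ball x xi d) 1 P) cd => //.
  by move=> v _ [].
move=> k k0; have m0 : 0 < Num.min d k by rewrite lt_min d0.
have [u [ou su]] := outward_acc m0; rewrite lt_min => /andP[ud uk].
by exists u; split.
Qed.

Lemma chain_sideP : chain_side E eps x xi <-> pinched.
Proof.
split=> [[d [d0 [u [hu cu]]]]|/pinched_chain[u [hu cu]]].
  by apply: (@chain_pinched u 1) cu => // n _; case: (hu n).
by exists 1; split => //; exists u.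
Qed.

(** Outside points with nonpositive tangential coordinate lie in the opposite cusp, so accumulating
    at [x] they would make [- xi] outward. *)
Lemma outside_right : ~ outward_directions E eps x (- xi) ->
  exists2 h : R, 0 < h & forall u, outside u -> rad u < h -> 0 < s u.
Proof.
move=> nxi; have e0 := eps0; apply: contrapT => H; apply: nxi.
apply/(outwardP cE eps0 _ bx); split.
  by rewrite enormN; apply/enorm_eqE => //; rewrite xi1 expr1n.
move=> h h0.
have m0 : 0 < Num.min h (h * eps) by rewrite lt_min h0 mulr_gt0.
have [u [ou uh su]] : exists u, [/\ outside u, rad u < Num.min h (h * eps) & s u <= 0].
  apply: contrapT => H'; apply: H; exists (Num.min h (h * eps)) => // u ou uh.
  by rewrite ltNge; apply/negP => su; apply: H'; exists u.
move: uh; rewrite lt_min => /andP[uh uhe].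
have ru := rad_gt0 (outside_boundary_neq cE eps0 bx ou).
exists u; split => //.
have cu := cusp eps0 xi1 Etop Ebot (outside_far ou).
have r2 := rad2 x xi1 u.
set w := _ - _.
have ww : dot w w = 2 + 2 * (s u / rad u).
  rewrite /w opprK -[xi]opprK -/(- xi) dot_sqrB !dotZl !dotZr dotNr.
  rewrite !dotNl !dotNr opprK xi1 -/(s u) -sqr_enorm -/(rad u).
  by field; rewrite gt_eqF.
rewrite enorm_ltE ?(ltW h0)// ww.
(* Cosine and sine of the direction: 1 + a <= b^2 since a <= 0, and the cusp inequality makes [b]
   small. *)
set a := s u / rad u; set b := t u / rad u.
have ab : a ^+ 2 + b ^+ 2 = 1.
  rewrite /a /b !expr_div_n -mulrDl -r2 divff// expf_neq0// gt_eqF//.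
have a0 : a <= 0 by rewrite pmulr_lle0 ?invr_gt0.
have a1 : -1 <= a.
  have := sqr_ge0 b; nra.
have bh : 2 * `|b| <= rad u / eps.
  rewrite ler_pdivlMr// /b normrM normfV (gtr0_norm ru).
  rewrite -(ler_pM2r ru) -expr2; apply: le_trans cu.
  by rewrite le_eqVlt; apply/orP; left; apply/eqP; field; rewrite gt_eqF.
have rh : rad u / eps < h by rewrite ltr_pdivrMr.
have b2 : 4 * b ^+ 2 < h ^+ 2.
  rewrite -[b ^+ 2]real_normK ?num_real//; have := normr_ge0 b; nra.
have : 1 + a <= b ^+ 2 by nra.
have := sqr_ge0 b.
lra.
Qed.

(** As a limit of outside points, [z] is not on the left; on the normal axis the cusp inequality
    excludes radii strictly between 0 and [2 * eps]. *)
Lemma boundary_right (h : R) : 0 < h ->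
  (forall u, outside u -> rad u < h -> 0 < s u) ->
  forall z, dN z -> z <> x -> rad z < Num.min h eps -> 0 < s z.
Proof.
move=> h0 H z bz zx; rewrite lt_min => /andP[zh ze]; have e0 := eps0.
have sz : 0 <= s z.
  rewrite leNgt; apply/negP => sz.
  have /(boundaryP cE eps0)[_ A] := bz.
  have [|u [ou uz]] := A (Num.min (- s z) (h - rad z)).
    by rewrite lt_min oppr_gt0 sz subr_gt0.
  move: uz; rewrite lt_min => /andP[us uh].
  have su : 0 < s u.
    by apply: H => //; have := enorm_triangle z u x; lra.
  have := dot_le (u - z) xi.
  have -> : dot (u - z) xi = s u - s z by rewrite /co1 !dotBl; ring.
  have -> : enorm xi = 1 by apply/enorm_eqE => //; rewrite xi1 expr1n.
  lra.
rewrite lt_def sz andbT; apply/eqP => sz0.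
have cz := cusp eps0 xi1 Etop Ebot (boundary_far cE eps0 bz).
have rz := rad_gt0 zx.
have := rad2 x xi1 z; rewrite sz0 expr0n add0r => r2.
have rt : rad z = `|t z|.
  apply/eqP; rewrite -(@eqrXn2 _ 2)// ?enorm_ge0// real_normK ?num_real//.
  exact/eqP.
rewrite -rt in cz; nra.
Qed.

(** When [- xi] is not outward, a small ball and its half ball have the same uncovered part. *)
Lemma sharpP : ~ outward_directions E eps x (- xi) ->
  (exists d : R, 0 < d /\ connected (eball x d `\` N)) <-> ~ pinched.
Proof.
move=> /outside_right[h h0 H]; split=> [[d [d0 cd]] P|].
  apply: (@pinched_disconnected (eball x d) h P) cd => //.
    by move=> v ov _; exact: H.
  move=> k k0; have m0 : 0 < Num.min d k by rewrite lt_min d0.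
  have [u [ou su]] := outward_acc m0; rewrite lt_min => /andP[ud uk].
  by exists u; split.
move=> /not_pinched_connected[d0 d00 K].
have m0 : 0 < Num.min d0 h by rewrite lt_min d00.
exists (Num.min d0 h); split => //.
have -> : eball x (Num.min d0 h) `\` N = half_ball x xi (Num.min d0 h) `\` N.
  apply/seteqP; split=> u [].
    move=> ud Nu; split => //; split => //; apply: H; first exact/(not_nbhdP cE eps0).
    by move: ud; rewrite /eball /= lt_min => /andP[].
  by case.
by apply: K => //; rewrite ge_min lexx.
Qed.

Lemma chainP : ~ outward_directions E eps x (- xi) ->
  (exists u : nat -> 'rV[R]_2, (forall n, u n <> x) /\ chain_sequence E eps x u)
  <-> pinched.
Proof.
move=> /outside_right[h h0 H]; split=> [[u [ux cu]]|/pinched_chain[u [hu cu]]].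
  have m0 : 0 < Num.min h eps by rewrite lt_min h0.
  apply: (chain_pinched m0 _ cu) => n un.
  by apply: (boundary_right h0 H) => //; case: cu => /(_ n)[].
exists u; split => // n ux; have [_] := hu n.
by rewrite ux -/(s x) co1_x ltxx.
Qed.

End Frame.

(** * Existence and uniqueness of the type *)

Lemma unit_neqN (xi : 'rV[R]_2) : dot xi xi = 1 -> xi <> - xi.
Proof.
move=> xi1 h; have : dot xi xi = - dot xi xi by rewrite {2}h dotNr.
by rewrite xi1; lra.
Qed.

Lemma shallow_sideP (x xi : 'rV[R]_2) :
  shallow_side E eps x xi <-> ~ smooth_side E eps x xi.
Proof.
split=> [H [d [d0]]|H d d0 K]; first exact: H.
by apply: H; exists d.
Qed.

Lemma two_contributors_not_unp (x a b : 'rV[R]_2) :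
  Ctr x a -> Ctr x b -> a <> b -> ~ unp E eps x.
Proof. by move=> Ca Cb ab [_ [y yE]]; apply: ab; move: Ca Cb; rewrite yE => -> ->. Qed.

(** Each side is smooth or shallow, and they are not both smooth. Chains are excluded by
    [single_no_chain], the remaining types by the opposite directions or the single contributor. *)
Lemma single_unique_type x a xi : dN x -> ~ smooth_point E eps x ->
  Ctr x = [set a] -> dot xi xi = 1 -> dot (a - x) xi = 0 ->
  extremal_directions E eps x = [set xi; - xi] ->
  exists! ty, has_type E eps x ty.
Proof.
move=> bx nsm Ca xi1 axi ext.
have ux : unp E eps x by split => //; exists a.
have nn := unit_neqN xi1.
have extN : extremal_directions E eps x = [set - xi; xi] by rewrite ext setUC.
have nchain xi' : chain_side E eps x xi' -> False.
  by move=> [d [_ [u [_ cu]]]]; exact: single_no_chain bx Ca cu.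
have lab xi1' xi2' : extremal_directions E eps x = [set xi1'; xi2'] ->
    [/\ xi1' <> xi2', xi1' = - xi2' &
      (xi1' = xi /\ xi2' = - xi) \/ (xi1' = - xi /\ xi2' = xi)].
  rewrite ext => h; have [[<- <-]|[<- <-]] := eq_set2 h; split; rewrite ?opprK//.
  - by left.
  - by move=> ?; apply: nn.
  - by right.
have [s1|s1] := pselect (smooth_side E eps x xi);
  have [s2|s2] := pselect (smooth_side E eps x (- xi)).
- by case: nsm; exact: single_smooth bx Ca xi1 axi s1 s2.
- exists Shallow; split.
    by exists xi, (- xi); split => //; split => //; exact/shallow_sideP.
  move=> [] [y1 [y2 [/lab[l1 l2 l3] /= T]]] //.
  + by case: T.
  + by case: T.
  + by case: T.
  + by case: T => _ /shallow_sideP h1 /shallow_sideP h2; case: l3 h1 h2 => -[-> ->].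
  + by case: T.
  + by case: T => _ _ /nchain.
  + by case: T => _ _ /nchain.
- exists Shallow; split.
    by exists (- xi), xi; split => //; split => //; exact/shallow_sideP.
  move=> [] [y1 [y2 [/lab[l1 l2 l3] /= T]]] //.
  + by case: T.
  + by case: T.
  + by case: T.
  + by case: T => _ /shallow_sideP h1 /shallow_sideP h2; case: l3 h1 h2 => -[-> ->].
  + by case: T.
  + by case: T => _ _ /nchain.
  + by case: T => _ _ /nchain.
- exists ShallowShallow; split.
    by exists xi, (- xi); split => //; split => //; exact/shallow_sideP.
  move=> [] [y1 [y2 [/lab[l1 l2 l3] /= T]]] //.
  + by case: T.
  + by case: T.
  + by case: T.
  + by case: T => _ + _; case: l3 => -[-> _].
  + by case: T.
  + by case: T => _ _ /nchain.
  + by case: T => _ _ /nchain.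
Qed.

(** Two contributors rule out the shallow types, and every other type but the wedge needs equal or
    opposite directions. *)
Lemma oblique_unique_type x a b xi1 xi2 : dN x -> Ctr x a -> Ctr x b ->
  a <> b -> xi1 <> xi2 -> xi1 <> - xi2 ->
  extremal_directions E eps x = [set xi1; xi2] ->
  exists! ty, has_type E eps x ty.
Proof.
move=> bx Ca Cb ab n12 n12' ext.
have nu := two_contributors_not_unp Ca Cb ab.
exists Wedge; split; first by exists xi1, xi2.
have lab y1 y2 : extremal_directions E eps x = [set y1; y2] ->
    y1 <> y2 /\ y1 <> - y2.
  rewrite ext => h; have [[<- <-]//|[<- <-]] := eq_set2 h; split => {}h;
    first by apply: n12.
  by apply: n12'; rewrite h opprK.
by move=> [] [y1 [y2 [/lab[l1 l2] /= T]]] //; case: T.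
Qed.

Lemma antipodal_unique_type x xi : dN x -> dot xi xi = 1 ->
  Ctr x (x + eps *: perp xi) -> Ctr x (x - eps *: perp xi) ->
  outward_directions E eps x xi ->
  extremal_directions E eps x = outward_directions E eps x ->
  (forall xi', outward_directions E eps x xi' -> xi' = xi \/ xi' = - xi) ->
  exists! ty, has_type E eps x ty.
Proof.
move=> bx xi1 Ct Cb oxi extE outs; have e0 := eps0.
have [Et _] := (contributorsP cE eps0 _ bx).1 Ct.
have [Eb _] := (contributorsP cE eps0 _ bx).1 Cb.
have nn := unit_neqN xi1.
have nu : ~ unp E eps x.
  apply: (two_contributors_not_unp Ct Cb) => /addrI h.
  have : dot (eps *: perp xi) (perp xi) = - dot (eps *: perp xi) (perp xi).
    by rewrite {1}h dotNl.
  by rewrite dotZl dot_perp_perp xi1; lra.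
(* One-sided types arise when [- xi] is not outward, two-sided ones when it is; pinching on each
   side then decides. *)
have [oN|oN] := pselect (outward_directions E eps x (- xi)); last first.
  have ext : extremal_directions E eps x = [set xi; xi].
    rewrite extE setUid; apply/seteqP; split=> [y oy|y ->//].
    by case: (outs _ oy) => // yE; case: oN; rewrite -yE.
  have lab y1 y2 : extremal_directions E eps x = [set y1; y2] -> y1 = xi /\ y2 = xi.
    by rewrite ext => h; have [[<- <-]|[<- <-]] := eq_set2 h.
  have sP := sharpP bx xi1 Et Eb oxi oN; have cP := chainP bx xi1 Et Eb oxi oN.
  have [P|P] := pselect (pinched x xi).
    exists Chain; split; first by exists xi, xi; split => //; split => //; exact/cP.
    move=> [] [y1 [y2 [/lab[-> ->] /= T]]] //; try by case: T.
    by case: T => _ /sP.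
  exists Sharp; split; first by exists xi, xi; split => //; split => //; exact/sP.
  move=> [] [y1 [y2 [/lab[-> ->] /= T]]] //; try by case: T.
  by case: T => _ /cP.
have ext : extremal_directions E eps x = [set xi; - xi].
  by rewrite extE; apply/seteqP; split=> [y /outs //|y [] ->].
have extN : extremal_directions E eps x = [set - xi; xi] by rewrite ext setUC.
have lab y1 y2 : extremal_directions E eps x = [set y1; y2] ->
    [/\ y1 <> y2, y1 = - y2 & (y1 = xi /\ y2 = - xi) \/ (y1 = - xi /\ y2 = xi)].
  rewrite ext => h; have [[<- <-]|[<- <-]] := eq_set2 h; split; rewrite ?opprK//.
  - by left.
  - by move=> ?; apply: nn.
  - by right.
have xi1N : dot (- xi) (- xi) = 1 by rewrite dotNl dotNr opprK.
(* Reversing [xi] exchanges the two centres, so the results for one side apply to the other. *)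
have EtN : E (x + eps *: perp (- xi)) by rewrite perpN scalerN.
have EbN : E (x - eps *: perp (- xi)) by rewrite perpN scalerN opprK.
have s1 := sharp_sideP bx xi1 Et Eb oxi; have c1 := chain_sideP bx xi1 Et Eb oxi.
have s2 := sharp_sideP bx xi1N EtN EbN oN; have c2 := chain_sideP bx xi1N EtN EbN oN.
have [P1|P1] := pselect (pinched x xi); have [P2|P2] := pselect (pinched x (- xi)).
- exists ChainChain; split.
    by exists xi, (- xi); split => //; split; rewrite ?opprK//; [exact/c1|exact/c2].
  move=> [] [y1 [y2 [/lab[l1 l2 l3] /= T]]] //; try by case: T.
  + by case: T => _ _; case: l3 => -[-> ->] => [/s1|/s2].
  + by case: T => _ + _; case: l3 => -[-> _] => [/s1|/s2].
(* The sharp side is listed first; here it is the side of [- xi]. *)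
- exists SharpChain; split.
    by exists (- xi), xi; split => //; split => //; [exact/s2|exact/c1].
  move=> [] [y1 [y2 [/lab[l1 l2 l3] /= T]]] //; try by case: T.
  + by case: T => _ _; case: l3 => -[-> ->] => [/s1|_ /s1].
  + by case: T => _; case: l3 => -[-> ->] => [_ /c2|/c2].
- exists SharpChain; split.
    by exists xi, (- xi); split => //; split; rewrite ?opprK//; [exact/s1|exact/c2].
  move=> [] [y1 [y2 [/lab[l1 l2 l3] /= T]]] //; try by case: T.
  + by case: T => _ _; case: l3 => -[-> ->] => [_ /s2|/s2].
  + by case: T => _; case: l3 => -[-> ->] => [/c1|_ /c1].
- exists SharpSharp; split.
    by exists xi, (- xi); split => //; split; rewrite ?opprK//; [exact/s1|exact/s2].
  move=> [] [y1 [y2 [/lab[l1 l2 l3] /= T]]] //; try by case: T.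
  + by case: T => _; case: l3 => -[-> ->] => [/c1|/c2].
  + by case: T => _ _; case: l3 => -[_ ->] => [/c2|/c1].
Qed.

End Sides.

Theorem theorem1 (R : realType) (E : set 'rV[R]_2) (eps : R)
    (x : 'rV[R]_2) :
  compact E -> 0 < eps ->
  boundary (nbhd E eps) x -> ~ smooth_point E eps x ->
  exists! t : singularity_type, has_type E eps x t.
Proof.
move=> cE eps0 bx nsm.
have [a [b [Ca Cb _ _ [xi ab CE xi1 axi ext|xi1 xi2 ab n1 n2 ext|
  xi xi1 oxi aE bE ext outs]]]] :=
  extremal_structure cE eps0 bx.
- exact: single_unique_type bx nsm CE xi1 axi ext.
- exact: oblique_unique_type bx Ca Cb ab n1 n2 ext.
- rewrite aE in Ca; rewrite bE in Cb.
  exact: antipodal_unique_type bx xi1 Ca Cb oxi ext outs.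
Qed.
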